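(* Let $n\ge1$ and $u\in\mathbb C$, and let $\ddot{\mathfrak H}^-$ be the rational spin double affine Hecke algebra with parameter $u$. Then the PBW property holds for $\ddot{\mathfrak H}^-$: multiplication $f\otimes\sigma\otimes g\mapsto f\sigma g$ gives rise to an isomorphism of vector spaces $$\mathcal C[\xi_1,\ldots,\xi_n]\otimes\mathbb C S_n^-\otimes\mathbb C[y_1,\ldots,y_n]\xrightarrow{\ \cong\ }\ddot{\mathfrak H}^-.$$
   Context: The spin symmetric group algebra $\mathbb C S_n^-$ is the $\mathbb C$-algebra generated by $t_1,\dots,t_{n-1}$ subject to $t_i^2=1$, $t_it_{i+1}t_i=t_{i+1}t_it_{i+1}$, and $t_it_j=-t_jt_i$ for $|i-j|>1$. For $1\le i<j\le n$ set $[i,j]=-[j,i]=(-1)^{j-i-1}t_{j-1}\cdots t_{i+1}t_it_{i+1}\cdots t_{j-1}$. The rational spin double affine Hecke algebra $\ddot{\mathfrak H}^-$ with parameter $u\in\mathbb C$ is the $\mathbb C$-algebra generated by $\xi_i,y_i$ ($1\le i\le n$) and $t_i$ ($1\le i\le n-1$), subject to the relations $t_i^2=1$, $t_it_{i+1}t_i=t_{i+1}t_it_{i+1}$, $t_it_j=-t_jt_i$ for $|i-j|>1$, and: $\xi_i\xi_j=-\xi_j\xi_i$, $y_iy_j=y_jy_i$ for $i\neq j$; $t_i\xi_i=-\xi_{i+1}t_i$, $t_iy_i=y_{i+1}t_i$; $t_j\xi_i=-\xi_it_j$, $t_jy_i=y_it_j$ for $i\neq j,j+1$; the commutator relations $y_i\xi_j-\xi_jy_i=u[i,j]$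 for $i\ne j$, and $y_i\xi_i-\xi_iy_i=u\sum_{k\neq i}[i,k]$. $\mathcal C[\xi_1,\dots,\xi_n]$ denotes the algebra generated by $\xi_1,\dots,\xi_n$ subject to the relations $\xi_i\xi_j=-\xi_j\xi_i$ for $i\ne j$; it has linear basis the monomials $\xi_1^{a_1}\cdots\xi_n^{a_n}$, $a_i\in\mathbb Z_{\geq0}$. *)

(* Defs.v *)
From HB Require Import structures.
From mathcomp Require Import all_boot all_algebra.
From mathcomp Require Import finmap boolp reals.
From mathcomp Require Export complex.
(* Both files define msupp and _@_ _; unqualified, these are those of mpoly,
   which must come last. Since {mpoly K[n]} can be parsed as the notation of
   monalg, the polynomial ring of mpoly is written mpoly n K. *)
From mathcomp Require Export monalg mpoly.

Set Implicit Arguments.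
Unset Strict Implicit.
Unset Printing Implicit Defensive.

Import GRing.Theory.
Local Open Scope ring_scope.
Local Open Scope quotient_scope.

Section QuotientModule.
Variables (K : nzRingType) (V : lmodType K) (S : V -> Prop).

Inductive lspan : V -> Prop :=
| lspan0 : lspan 0
| lspan_step c s v : S s -> lspan v -> lspan (c *: s + v).

Definition lspan_pred (v : V) : bool := `[< lspan v >].

Lemma lspanD v w : lspan v -> lspan w -> lspan (v + w).
Proof.
elim=> [|c s v' Ss _ IH] lw; first by rewrite add0r.
by rewrite -addrA; apply: lspan_step => //; apply: IH.
Qed.

Lemma lspanZ c v : lspan v -> lspan (c *: v).
Proof.
elim=> [|d s v' Ss _ IH]; first by rewrite scaler0; apply: lspan0.
by rewrite scalerDr scalerA; apply: lspan_step.
Qed.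

Lemma lspan_gen s : S s -> lspan s.
Proof. by move=> Ss; rewrite -[s]scale1r -[_ *: _]addr0; do ?constructor. Qed.

Fact lspan_zmod_closed : zmod_closed lspan_pred.
Proof.
split=> [|v w /asboolP lv /asboolP lw]; first exact/asboolP/lspan0.
by apply/asboolP; rewrite -scaleN1r; apply: lspanD => //; apply: lspanZ.
Qed.

HB.instance Definition _ :=
  GRing.isZmodClosed.Build V lspan_pred lspan_zmod_closed.

Definition lspan_zmod := GRing.ZmodClosed.clone V lspan_pred _.

Definition quotmod : Type := Quotient.quot lspan_zmod.
HB.instance Definition _ := GRing.Zmodule.on quotmod.

Definition qproj (v : V) : quotmod := \pi_(Quotient.quot lspan_zmod) v.
Definition qrepr (x : quotmod) : V :=
  repr (x : Quotient.quot lspan_zmod).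

Lemma qreprK x : qproj (qrepr x) = x.
Proof. exact: reprK. Qed.

Lemma qprojP v w : qproj v = qproj w <-> lspan (v - w).
Proof.
split=> [/eqP|lvw].
  by rewrite /qproj -Quotient.idealrBE => /asboolP.
by apply/eqP; rewrite /qproj -Quotient.idealrBE; apply/asboolP.
Qed.

Lemma qprojD v w : qproj (v + w) = qproj v + qproj w.
Proof. exact: (raddfD \pi_(Quotient.quot lspan_zmod)). Qed.

Definition qscale c (x : quotmod) : quotmod := qproj (c *: qrepr x).

Lemma qprojZ_subproof c v : qproj (c *: v) = qscale c (qproj v).
Proof.
by apply/qprojP; rewrite -scalerBr; apply/lspanZ/qprojP; rewrite qreprK.
Qed.

Fact qscaleA c d x : qscale c (qscale d x) = qscale (c * d) x.
Proof. by rewrite -[x]qreprK -!qprojZ_subproof scalerA. Qed.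
Fact qscale1 : left_id 1 qscale.
Proof. by move=> x; rewrite -[x]qreprK -qprojZ_subproof scale1r. Qed.
Fact qscaleDr : right_distributive qscale +%R.
Proof.
move=> c x y; rewrite -[x]qreprK -[y]qreprK -qprojD -!qprojZ_subproof.
by rewrite scalerDr qprojD.
Qed.
Fact qscaleDl x : {morph qscale^~ x : c d / c + d}.
Proof.
by move=> c d; rewrite -[x]qreprK -!qprojZ_subproof scalerDl qprojD.
Qed.

HB.instance Definition _ :=
  GRing.Zmodule_isLmodule.Build K quotmod qscaleA qscale1 qscaleDr qscaleDl.

Fact qproj_is_linear : linear qproj.
Proof. by move=> c v w; rewrite qprojD qprojZ_subproof. Qed.
HB.instance Definition _ :=
  GRing.isLinear.Build K V quotmod *:%R qproj qproj_is_linear.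

End QuotientModule.

Section Tensor.
Variables (K : comNzRingType) (U V : lmodType K).

Inductive tensor_rel : {malg K[(U * V)%type]} -> Prop :=
| tensorDl u u' v :
    tensor_rel (<< (u + u', v) >> - (<< (u, v) >> + << (u', v) >>))
| tensorDr u v v' :
    tensor_rel (<< (u, v + v') >> - (<< (u, v) >> + << (u, v') >>))
| tensorZl c u v : tensor_rel (<< (c *: u, v) >> - c *: << (u, v) >>)
| tensorZr c u v : tensor_rel (<< (u, c *: v) >> - c *: << (u, v) >>).

Definition tensor : Type := quotmod tensor_rel.
HB.instance Definition _ := GRing.Lmodule.on tensor.

Definition tens (u : U) (v : V) : tensor := qproj tensor_rel << (u, v) >>.

End Tensor.

Notation freealg K X := {malg K[{fmonom X}]}.

(* Locked: unification must not unfold products of generators. *)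
HB.lock Definition fgen (K : comNzRingType) (X : choiceType) (x : X)
  : freealg K X := << fmu x >>.
Arguments fgen K {X} x.

Section FreeAlgebra.
Variables (K : comNzRingType) (X : choiceType).

Lemma freealg_scalerAr (c : K) (x y : freealg K X) :
  c *: (x * y) = x * (c *: y).
Proof.
apply/malgP=> k; rewrite monalg.mcoeffZ.
rewrite (monalg.mcoeffMlw _ (fsubset_refl _) (fsubset_refl _)).
rewrite (monalg.mcoeffMlw _ (fsubset_refl _) (monalg.msuppZ_le c y)).
rewrite mulr_sumr; apply: eq_bigr => k1 _; rewrite mulr_sumr.
by apply: eq_bigr => k2 _; rewrite monalg.mcoeffZ mulrnAr mulrCA.
Qed.

End FreeAlgebra.

(* The quotient is a pzRingType and an lmodType but not an lalgType, which in
   MathComp requires 1 != 0: for an algebra given by generators and relations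
   this is not known beforehand. The missing compatibilities are
   presalg_scalerAl and presalg_scalerAr. *)
Section PresentedAlgebra.
Variables (K : comNzRingType) (X : choiceType).
Variable rel : freealg K X -> freealg K X -> Prop.

Definition ideal_gens (x : freealg K X) : Prop :=
  exists a l r b, rel l r /\ x = a * (l - r) * b.

Definition presalg : Type := quotmod ideal_gens.
HB.instance Definition _ := GRing.Lmodule.on presalg.

Definition pproj (x : freealg K X) : presalg := qproj ideal_gens x.
Fact pproj_is_linear : linear pproj.
Proof. exact: (linearP (qproj ideal_gens)). Qed.
HB.instance Definition _ :=
  GRing.isLinear.Build K (freealg K X) presalg *:%R pproj pproj_is_linear.

Lemma pprojZ c : {morph pproj : x / c *: x}.
Proof. exact: linearZ. Qed.

Lemma pprojD : {morph pproj : x y / x + y}.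
Proof. exact: qprojD. Qed.

Definition prepr (x : presalg) : freealg K X := qrepr x.
Definition pgen (a : X) : presalg := pproj (fgen K a).

Lemma preprK x : pproj (prepr x) = x.
Proof. exact: qreprK. Qed.

Lemma ideal_mull x y : lspan ideal_gens y -> lspan ideal_gens (x * y).
Proof.
elim=> [|c s v [a [l [r [b [lr ->]]]]] _ IH].
  by rewrite mulr0; apply: lspan0.
rewrite mulrDr -freealg_scalerAr; apply: lspan_step => //.
by exists (x * a), l, r, b; rewrite !mulrA.
Qed.

Lemma ideal_mulr x y : lspan ideal_gens x -> lspan ideal_gens (x * y).
Proof.
elim=> [|c s v [a [l [r [b [lr ->]]]]] _ IH].
  by rewrite mul0r; apply: lspan0.
rewrite mulrDl -scalerAl; apply: lspan_step => //.
by exists a, l, r, (b * y); rewrite !mulrA.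
Qed.

Definition pone : presalg := pproj 1.
Definition pmul (x y : presalg) : presalg := pproj (prepr x * prepr y).

Lemma pprojM_subproof x y : pproj (x * y) = pmul (pproj x) (pproj y).
Proof.
apply/qprojP; set x' := prepr _; set y' := prepr _.
have -> : x * y - x' * y' = (x - x') * y + x' * (y - y').
  by rewrite mulrBl mulrBr addrA subrK.
by apply: lspanD; [apply: ideal_mulr | apply: ideal_mull];
  exact/qprojP/esym/preprK.
Qed.

Fact pmulA : associative pmul.
Proof.
by move=> x y z; rewrite -[x]preprK -[y]preprK -[z]preprK -!pprojM_subproof
  mulrA.
Qed.
Fact pmul1 : left_id pone pmul.
Proof. by move=> x; rewrite -[x]preprK -pprojM_subproof mul1r. Qed.
Fact pmulr1 : right_id pone pmul.
Proof. by move=> x; rewrite -[x]preprK -pprojM_subproof mulr1. Qed.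
Fact pmulDl : left_distributive pmul +%R.
Proof.
move=> x y z; rewrite -{1}[x]preprK -{1}[y]preprK -{1}[z]preprK.
by rewrite -[pproj _ + _]pprojD -pprojM_subproof mulrDl; apply: pprojD.
Qed.
Fact pmulDr : right_distributive pmul +%R.
Proof.
move=> x y z; rewrite -{1}[x]preprK -{1}[y]preprK -{1}[z]preprK.
by rewrite -[pproj _ + pproj (prepr z)]pprojD -pprojM_subproof mulrDr;
  apply: pprojD.
Qed.

HB.instance Definition _ :=
  GRing.Zmodule_isPzRing.Build presalg pmulA pmul1 pmulr1 pmulDl pmulDr.

Lemma pprojN x : pproj (- x) = - pproj x.
Proof. exact: linearN. Qed.

Lemma pproj1 : pproj 1 = 1.
Proof. by []. Qed.

Lemma pprojM x y : pproj (x * y) = pproj x * pproj y.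
Proof. exact: pprojM_subproof. Qed.

Fact presalg_scalerAl (c : K) (x y : presalg) : c *: (x * y) = (c *: x) * y.
Proof.
rewrite -{1}[x]preprK -{1}[y]preprK -pprojM -pprojZ scalerAl pprojM pprojZ.
by rewrite !preprK.
Qed.
Fact presalg_scalerAr (c : K) (x y : presalg) : c *: (x * y) = x * (c *: y).
Proof.
rewrite -{1}[x]preprK -{1}[y]preprK -pprojM -pprojZ freealg_scalerAr pprojM.
by rewrite pprojZ !preprK.
Qed.
Lemma pproj_rel l r : rel l r -> pproj l = pproj r.
Proof.
move=> lr; apply/qprojP/lspan_gen.
by exists 1, l, r, 1; rewrite mul1r mulr1.
Qed.

End PresentedAlgebra.

Section Lift.
Variables (K : comNzRingType) (X Y : choiceType).
Variable relY : freealg K Y -> freealg K Y -> Prop.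
Local Notation B := (presalg relY).
Variable h : X -> B.

Definition feval (x : freealg K X) : B :=
  \sum_(w <- monalg.msupp x) monalg.mcoeff w x *: \prod_(a <- (w : seq X)) h a.

Lemma fevalEw (d : {fset {fmonom X}}) x : (monalg.msupp x `<=` d)%fset ->
  feval x = \sum_(w <- d) monalg.mcoeff w x *: \prod_(a <- (w : seq X)) h a.
Proof.
move=> le; rewrite /feval (big_fset_incl _ le) => //= w wd /mcoeff_outdom ->.
by rewrite scale0r.
Qed.

Fact feval_is_linear : linear feval.
Proof.
move=> c x y; pose d := (monalg.msupp x `|` monalg.msupp y)%fset.
have lx : (monalg.msupp x `<=` d)%fset by apply: fsubsetUl.
have ly : (monalg.msupp y `<=` d)%fset by apply: fsubsetUr.
have lxy : (monalg.msupp (c *: x + y) `<=` d)%fset.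
  apply: (fsubset_trans (monalg.msuppD_le _ _)).
  by apply: fsetSU; apply: monalg.msuppZ_le.
rewrite (fevalEw lx) (fevalEw ly) (fevalEw lxy) scaler_sumr -big_split /=.
apply: eq_bigr => w _.
by rewrite monalg.mcoeffD monalg.mcoeffZ scalerDl scalerA.
Qed.
HB.instance Definition _ :=
  GRing.isLinear.Build K (freealg K X) B *:%R feval feval_is_linear.

Lemma fevalU c w : feval << c *g w >> = c *: \prod_(a <- (w : seq X)) h a.
Proof. by rewrite (fevalEw monalg.msuppU_le) big_seq_fset1 mcoeffUU. Qed.

Lemma feval_gen x : feval (fgen K x) = h x.
Proof. by rewrite fgen.unlock fevalU scale1r fmU big_seq1. Qed.

Lemma feval1 : feval 1 = 1.
Proof. by rewrite [1]/(<< _ *g _ >>) fevalU scale1r fm1 big_nil. Qed.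

Lemma fevalN x : feval (- x) = - feval x.
Proof. exact: linearN. Qed.

Lemma fevalM x y : feval (x * y) = feval x * feval y.
Proof.
rewrite malgME linear_sum /= {2 3}/feval mulr_suml; apply: eq_bigr => w _.
rewrite linear_sum mulr_sumr; apply: eq_bigr => w' _ /=.
by rewrite fevalU fmM big_cat /= -presalg_scalerAl -presalg_scalerAr scalerA.
Qed.

Variable rel : freealg K X -> freealg K X -> Prop.

(* The algebra morphism sending pgen a to h a; see plift_linear, pliftM, plift1
   and plift_gen when h respects the relations. *)
Definition plift (x : presalg rel) : B := feval (prepr x).

Hypothesis h_rel : forall l r, rel l r -> feval l = feval r.

Lemma plift_proj x : plift (pproj rel x) = feval x.
Proof.
have feval0 y : lspan (ideal_gens rel) y -> feval y = 0.
  elim=> [|c s v [a [l [r [b [lr ->]]]]] _ IH]; first exact: linear0.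
  rewrite linearP /= IH !fevalM linearB /= (h_rel lr) subrr mulr0 mul0r.
  by rewrite scaler0 addr0.
apply/eqP; rewrite -subr_eq0 -[_ - _]linearB; apply/eqP/feval0/qprojP.
exact: preprK.
Qed.

Lemma plift_gen a : plift (pgen rel a) = h a.
Proof. by rewrite plift_proj feval_gen. Qed.

Lemma plift_linear : linear plift.
Proof.
move=> c x y; rewrite -[x](preprK (rel := rel)) -[y]preprK -linearP !plift_proj.
exact: linearP.
Qed.

Lemma pliftM x y : plift (x * y) = plift x * plift y.
Proof.
rewrite -[x](preprK (rel := rel)) -[y]preprK -pprojM !plift_proj.
exact: fevalM.
Qed.

Lemma plift1 : plift 1 = 1.
Proof. by rewrite -pproj1 plift_proj feval1. Qed.

End Lift.
Arguments plift {K X Y relY} h {rel} x.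

(* Indices start at 0: xi i and y i for i < n, and t k for k < n.-1, where t k
   exchanges the indices k and k.+1. *)
Section Relations.
Variable n : nat.

Inductive spin_rel (A : pzRingType) (t : 'I_n.-1 -> A) : A -> A -> Prop :=
| spin_sq i : spin_rel t (t i * t i) 1
| spin_braid (i j : 'I_n.-1) : j = i.+1 :> nat ->
    spin_rel t (t i * t j * t i) (t j * t i * t j)
| spin_far (i j : 'I_n.-1) : (i.+1 < j)%N || (j.+1 < i)%N ->
    spin_rel t (t i * t j) (- (t j * t i)).

Inductive skew_rel (A : pzRingType) (xi : 'I_n -> A) : A -> A -> Prop :=
| skew_xi i j : i != j -> skew_rel xi (xi i * xi j) (- (xi j * xi i)).

(* (-1)^(j-i-1) t_(j-1) ... t_(i+1) t_i t_(i+1) ... t_(j-1), for i < j *)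
Definition bracket_lt (A : pzRingType) (t : 'I_n.-1 -> A) (i j : 'I_n) : A :=
  (-1) ^+ (j - i).-1
  * \prod_(k <- rev (enum 'I_n.-1) | (i < k < j)%N) t k
  * \prod_(k <- enum 'I_n.-1 | (i <= k < j)%N) t k.

(* Only meaningful for i != j. *)
Definition bracket (A : pzRingType) (t : 'I_n.-1 -> A) (i j : 'I_n) : A :=
  if (i < j)%N then bracket_lt t i j else - bracket_lt t j i.

Inductive sdaha_rel (K : comNzRingType) (u : K) (A : lalgType K)
    (xi y : 'I_n -> A) (t : 'I_n.-1 -> A) : A -> A -> Prop :=
| sdaha_spin l r : spin_rel t l r -> sdaha_rel u xi y t l r
| sdaha_skew l r : skew_rel xi l r -> sdaha_rel u xi y t l r
| sdaha_yy i j : i != j -> sdaha_rel u xi y t (y i * y j) (y j * y i)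
| sdaha_t_xi (k : 'I_n.-1) (i j : 'I_n) : i = k :> nat -> j = k.+1 :> nat ->
    sdaha_rel u xi y t (t k * xi i) (- (xi j * t k))
| sdaha_t_y (k : 'I_n.-1) (i j : 'I_n) : i = k :> nat -> j = k.+1 :> nat ->
    sdaha_rel u xi y t (t k * y i) (y j * t k)
| sdaha_t_xi_far (k : 'I_n.-1) (i : 'I_n) : i != k :> nat -> i != k.+1 :> nat ->
    sdaha_rel u xi y t (t k * xi i) (- (xi i * t k))
| sdaha_t_y_far (k : 'I_n.-1) (i : 'I_n) : i != k :> nat -> i != k.+1 :> nat ->
    sdaha_rel u xi y t (t k * y i) (y i * t k)
| sdaha_y_xi_neq i j : i != j ->
    sdaha_rel u xi y t (y i * xi j - xi j * y i) (u *: bracket t i j)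
| sdaha_y_xi i :
    sdaha_rel u xi y t (y i * xi i - xi i * y i)
      (u *: \sum_(k | k != i) bracket t i k).

End Relations.

Section Algebras.
Variables (K : comNzRingType) (n : nat).

Definition skewpoly : Type := presalg (@skew_rel n (freealg K 'I_n) (fgen K)).
HB.instance Definition _ := GRing.Lmodule.on skewpoly.
HB.instance Definition _ := GRing.PzRing.on skewpoly.

Definition spinsym : Type :=
  presalg (@spin_rel n (freealg K 'I_n.-1) (fgen K)).
HB.instance Definition _ := GRing.Lmodule.on spinsym.
HB.instance Definition _ := GRing.PzRing.on spinsym.

Definition sdaha_gen : Type := ('I_n + 'I_n + 'I_n.-1)%type.
HB.instance Definition _ := Choice.on sdaha_gen.
Definition gen_xi (i : 'I_n) : sdaha_gen := inl (inl i).
Definition gen_y (i : 'I_n) : sdaha_gen := inl (inr i).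
Definition gen_t (k : 'I_n.-1) : sdaha_gen := inr k.

Variable u : K.

Definition sdaha : Type :=
  presalg (@sdaha_rel n K u (freealg K sdaha_gen)
    (fgen K \o gen_xi) (fgen K \o gen_y) (fgen K \o gen_t)).
HB.instance Definition _ := GRing.Lmodule.on sdaha.
HB.instance Definition _ := GRing.PzRing.on sdaha.

Definition sdaha_xi (i : 'I_n) : sdaha := pgen _ (gen_xi i).
Definition sdaha_y (i : 'I_n) : sdaha := pgen _ (gen_y i).
Definition sdaha_t (k : 'I_n.-1) : sdaha := pgen _ (gen_t k).

Definition skewpoly_in : skewpoly -> sdaha := plift sdaha_xi.
Definition spinsym_in : spinsym -> sdaha := plift sdaha_t.

(* mmap is not available: it requires the target ring to be nontrivial. *)
Definition poly_in (g : mpoly n K) : sdaha :=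
  \sum_(m <- msupp g) g@_m *: \prod_(i < n) sdaha_y i ^+ m i.

Lemma sdaha_pproj (l r : freealg K sdaha_gen) :
    sdaha_rel u (fgen K \o gen_xi) (fgen K \o gen_y) (fgen K \o gen_t) l r ->
  pproj _ l = pproj _ r :> sdaha.
Proof. exact: pproj_rel. Qed.

Lemma skewpoly_in_rel (l r : freealg K 'I_n) :
  skew_rel (fgen K) l r -> feval sdaha_xi l = feval sdaha_xi r.
Proof.
case=> i j ij.
have e := sdaha_pproj (sdaha_skew _ _ _ (skew_xi (fgen K \o gen_xi) ij)).
rewrite [LHS]pprojM [RHS]pprojN [X in _ = - X]pprojM in e.
rewrite [LHS]fevalM [RHS]fevalN [X in _ = - X]fevalM !feval_gen.
exact: e.
Qed.

Lemma spinsym_in_rel (l r : freealg K 'I_n.-1) :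
  spin_rel (fgen K) l r -> feval sdaha_t l = feval sdaha_t r.
Proof.
case=> [i|i j ij|i j ij].
- have e := sdaha_pproj (sdaha_spin _ _ _ (spin_sq (fgen K \o gen_t) i)).
  rewrite [LHS]pprojM in e.
  rewrite [LHS]fevalM [RHS]feval1 !feval_gen; exact: e.
- have e := sdaha_pproj (sdaha_spin _ _ _ (spin_braid (fgen K \o gen_t) ij)).
  rewrite [LHS]pprojM [X in X * _]pprojM [RHS]pprojM in e.
  rewrite [X in _ = X * _]pprojM in e.
  rewrite [LHS]fevalM [X in X * _]fevalM [RHS]fevalM [X in _ = X * _]fevalM.
  rewrite !feval_gen; exact: e.
- have e := sdaha_pproj (sdaha_spin _ _ _ (spin_far (fgen K \o gen_t) ij)).
  rewrite [LHS]pprojM [RHS]pprojN [X in _ = - X]pprojM in e.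
  rewrite [LHS]fevalM [RHS]fevalN [X in _ = - X]fevalM !feval_gen.
  exact: e.
Qed.

Lemma skewpoly_in_gen i : skewpoly_in (pgen _ i) = sdaha_xi i.
Proof. exact/plift_gen/skewpoly_in_rel. Qed.
Lemma skewpoly_in_linear : linear skewpoly_in.
Proof. exact/plift_linear/skewpoly_in_rel. Qed.
Lemma skewpoly_inM x y : skewpoly_in (x * y) = skewpoly_in x * skewpoly_in y.
Proof. exact/pliftM/skewpoly_in_rel. Qed.
Lemma skewpoly_in1 : skewpoly_in 1 = 1.
Proof. exact/plift1/skewpoly_in_rel. Qed.

Lemma spinsym_in_gen k : spinsym_in (pgen _ k) = sdaha_t k.
Proof. exact/plift_gen/spinsym_in_rel. Qed.
Lemma spinsym_in_linear : linear spinsym_in.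
Proof. exact/plift_linear/spinsym_in_rel. Qed.
Lemma spinsym_inM x y : spinsym_in (x * y) = spinsym_in x * spinsym_in y.
Proof. exact/pliftM/spinsym_in_rel. Qed.
Lemma spinsym_in1 : spinsym_in 1 = 1.
Proof. exact/plift1/spinsym_in_rel. Qed.

End Algebras.

(* Main.v *)
Require Import Defs.
From HB Require Import structures.
From mathcomp Require Import all_boot all_fingroup all_algebra.
From mathcomp Require Import finmap boolp.
From mathcomp Require Import reals complex monalg ssrcomplements mpoly zify.
Set Implicit Arguments.
Unset Strict Implicit.
Unset Printing Implicit Defensive.
Import GRing.Theory.
Local Open Scope ring_scope.

(** The algebra H acts on the tensor product N of the skew polynomials S, the
    spin algebra T and the polynomials P, and this action inverts the
    multiplication map.

    The action is built in two layers, by the universal property of an induced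
    module: if A is an algebra given by generators and relations, and operators
    on W satisfy the relations, then every linear map from B to W extends
    uniquely to a map from A (x) B to W that commutes with the generators.  On
    T (x) P the generators t_k act by left multiplication, and
    y_i is forced by y_i t_k = t_k y_(s_k i): the whole family (y_i)_i is the
    map into the functions from indices to T (x) P on which t_k acts by
    composing with the transposition s_k (ex_y_spin).  On N = S (x) (T (x) P)
    the xi_j act by left multiplication and t_k is forced by
    t_k xi_j = - xi_(s_k j) t_k (ex_t_skew).  Finally y_i is forced by
    y_i xi_j = xi_j y_i + u c_ij, where u c_ij is the prescribed commutator:
    the pair (y_i m, m) is the map into N * N on which xi_j acts
    by (m', m) |-> (xi_j m' + u c_ij m, xi_j m) (ex_deform).

    These operators exist and satisfy the relations of H because of two
    identities between brackets.  The operators on N * N anticommute by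
    skew_jacobi, which expresses that y_i respects xi_j xi_l = - xi_l xi_j, and
    the y_i commute by comm_jacobi.  Both follow from the rule that a bracket
    [i,j] moves past xi_l (up to sign) and y_l by applying the transposition
    (i j) to the index (bracket_move).  The rule
    t_k [i,j] = - [s_k i, s_k j] t_k makes t_k compatible with the commutators
    (bracket_conj).

    Once N is an H-module, nu x = x (1 (x) 1 (x) 1) maps H to N.  The
    multiplication map mu from N to H commutes with all generators, so mu nu is
    H-linear and fixes 1, and nu mu commutes with the xi_j and t_k and fixes
    1 (x) 1 (x) P; both are therefore the identity (pbw_iso).
    No basis of S or T is used, so the coefficients may form any commutative
    ring.

    The records tensor_prod and induced describe tensor products and induced
    modules by their universal properties; the operators and the
    isomorphism are built for arbitrary instances, and quotients enter only
    where instances are constructed and in the final comparison. *)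

(** * Linear maps and endomorphisms *)

(** Locked, so that unification does not unfold maps defined on quotients. *)
HB.lock Definition linear_of (K : nzRingType) (U W : lmodType K) (f : U -> W)
    (lf : linear f) : {linear U -> W} :=
  let m := GRing.isLinear.Build K U W *:%R f lf in HB.pack f m.

Lemma linear_ofE (K : nzRingType) (U W : lmodType K) (f : U -> W)
  (lf : linear f) : linear_of lf =1 f.
Proof. by rewrite linear_of.unlock. Qed.

Section LinearEnd.
Variables (K : comNzRingType) (W : lmodType K).

(** The module may be zero, so these operators form a ring in which 1 = 0 is
    possible, as it is a priori in a quotient algebra acting on the module. *)
Record lend := Lend { lend_fun :> W -> W; lend_linear : linear lend_fun }.

HB.instance Definition _ := gen_eqMixin lend.
HB.instance Definition _ := gen_choiceMixin lend.
HB.instance Definition _ (f : lend) :=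
  GRing.isLinear.Build K W W *:%R f (lend_linear f).

Lemma lendP (f g : lend) : f =1 g -> f = g.
Proof.
case: f g => [f lf] [g lg] /funext /= fg; subst g.
by congr Lend; apply: Prop_irrelevance.
Qed.

Fact lend_add_linear (f g : lend) : linear (fun m => f m + g m).
Proof. by move=> c m m'; rewrite !linearP scalerDr addrACA. Qed.
Fact lend_opp_linear (f : lend) : linear (fun m => - f m).
Proof. by move=> c m m'; rewrite linearP opprD scalerN. Qed.
Fact lend_zero_linear : linear (fun _ : W => 0 : W).
Proof. by move=> c m m'; rewrite scaler0 addr0. Qed.
Fact lend_one_linear : linear (fun m : W => m).
Proof. by []. Qed.
Fact lend_mul_linear (f g : lend) : linear (fun m => f (g m)).
Proof. by move=> c m m'; rewrite !linearP. Qed.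
Fact lend_scale_linear c (f : lend) : linear (fun m => c *: f m).
Proof. by move=> d m m'; rewrite linearP scalerDr !scalerA mulrC. Qed.

Definition lend_add f g := Lend (lend_add_linear f g).
Definition lend_opp f := Lend (lend_opp_linear f).
Definition lend_zero := Lend lend_zero_linear.
Definition lend_one := Lend lend_one_linear.
Definition lend_mul f g := Lend (lend_mul_linear f g).
Definition lend_scale c f := Lend (lend_scale_linear c f).

Fact lend_addA : associative lend_add.
Proof. by move=> f g h; apply: lendP => m /=; rewrite addrA. Qed.
Fact lend_addC : commutative lend_add.
Proof. by move=> f g; apply: lendP => m /=; rewrite addrC. Qed.
Fact lend_add0 : left_id lend_zero lend_add.
Proof. by move=> f; apply: lendP => m /=; rewrite add0r. Qed.
Fact lend_addN : left_inverse lend_zero lend_opp lend_add.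
Proof. by move=> f; apply: lendP => m /=; rewrite addNr. Qed.
HB.instance Definition _ :=
  GRing.isZmodule.Build lend lend_addA lend_addC lend_add0 lend_addN.

Fact lend_mulA : associative lend_mul.
Proof. by move=> f g h; apply: lendP. Qed.
Fact lend_mul1 : left_id lend_one lend_mul.
Proof. by move=> f; apply: lendP. Qed.
Fact lend_mulr1 : right_id lend_one lend_mul.
Proof. by move=> f; apply: lendP. Qed.
Fact lend_mulDl : left_distributive lend_mul +%R.
Proof. by move=> f g h; apply: lendP. Qed.
Fact lend_mulDr : right_distributive lend_mul +%R.
Proof. by move=> f g h; apply: lendP => m /=; rewrite linearD. Qed.
HB.instance Definition _ := GRing.Zmodule_isPzRing.Build lend
  lend_mulA lend_mul1 lend_mulr1 lend_mulDl lend_mulDr.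

Fact lend_scaleA c d f : lend_scale c (lend_scale d f) = lend_scale (c * d) f.
Proof. by apply: lendP => m /=; rewrite scalerA. Qed.
Fact lend_scale1 : left_id 1 lend_scale.
Proof. by move=> f; apply: lendP => m /=; rewrite scale1r. Qed.
Fact lend_scaleDr : right_distributive lend_scale +%R.
Proof. by move=> c f g; apply: lendP => m /=; rewrite scalerDr. Qed.
Fact lend_scaleDl f : {morph lend_scale^~ f : c d / c + d}.
Proof. by move=> c d; apply: lendP => m /=; rewrite scalerDl. Qed.
HB.instance Definition _ := GRing.Zmodule_isLmodule.Build K lend
  lend_scaleA lend_scale1 lend_scaleDr lend_scaleDl.

Lemma lendDE (f g : lend) m : (f + g) m = f m + g m. Proof. by []. Qed.
Lemma lendNE (f : lend) m : (- f) m = - f m. Proof. by []. Qed.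
Lemma lendME (f g : lend) m : (f * g) m = f (g m). Proof. by []. Qed.
Lemma lend1E m : (1 : lend) m = m. Proof. by []. Qed.
Lemma lendZE c (f : lend) m : (c *: f) m = c *: f m. Proof. by []. Qed.

Lemma lend_scalerAl c (f g : lend) : c *: (f * g) = (c *: f) * g.
Proof. exact: lendP. Qed.
Lemma lend_scalerAr c (f g : lend) : c *: (f * g) = f * (c *: g).
Proof. by apply: lendP => m; rewrite lendZE !lendME lendZE linearZ. Qed.
End LinearEnd.

Section MalgLift.
Variables (K : comNzRingType) (I : choiceType) (W : lmodType K) (phi : I -> W).

Definition malg_lift (x : {malg K[I]}) : W :=
  \sum_(k <- monalg.msupp x) monalg.mcoeff k x *: phi k.

Lemma malg_liftEw (d : {fset I}) x : (monalg.msupp x `<=` d)%fset ->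
  malg_lift x = \sum_(k <- d) monalg.mcoeff k x *: phi k.
Proof.
move=> le; rewrite /malg_lift (big_fset_incl _ le) => //= k kd.
by move/mcoeff_outdom=> ->; rewrite scale0r.
Qed.

Fact malg_lift_linear : linear malg_lift.
Proof.
move=> c x y; pose d := (monalg.msupp x `|` monalg.msupp y)%fset.
rewrite (malg_liftEw (fsubsetUl _ _ : _ `<=` d)%fset).
rewrite (malg_liftEw (fsubsetUr _ _ : _ `<=` d)%fset).
rewrite (@malg_liftEw d); last first.
  exact: (fsubset_trans (monalg.msuppD_le _ _) (fsetSU _ (monalg.msuppZ_le _ _))).
rewrite scaler_sumr -big_split /=; apply: eq_bigr => k _.
by rewrite monalg.mcoeffD monalg.mcoeffZ scalerDl scalerA.
Qed.
HB.instance Definition _ :=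
  GRing.isLinear.Build K {malg K[I]} W *:%R malg_lift malg_lift_linear.

Lemma malg_liftU k : malg_lift << k >> = phi k.
Proof.
by rewrite (malg_liftEw monalg.msuppU_le) big_seq_fset1 mcoeffUU scale1r.
Qed.
End MalgLift.

Lemma malg_ind (K : comNzRingType) (I : choiceType) (Q : {malg K[I]} -> Prop) :
    Q 0 -> (forall c x y, Q x -> Q y -> Q (c *: x + y)) ->
    (forall k, Q << k >>) -> forall x, Q x.
Proof.
move=> Q0 QD QU x; rewrite [x]monalgE; elim: (enum_fset _) => [|k s IH].
  by rewrite big_nil.
rewrite big_cons; have -> (z : K) : << z *g k >> = z *: << k >> :> {malg K[I]}.
  by apply/malgP=> l; rewrite monalg.mcoeffZ !mcoeffU mulrnAr mulr1.
exact: QD.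
Qed.

Section QuotLift.
Variables (K : nzRingType) (V : lmodType K) (S : V -> Prop) (W : lmodType K).
Variable phi : {linear V -> W}.
Hypothesis phiS : forall s, S s -> phi s = 0.

(** Any representative may be evaluated, since phi vanishes on the subspace by
    which the quotient is taken. *)
Definition qlift (x : quotmod S) : W := phi (qrepr x).

Lemma qlift_proj v : qlift (qproj S v) = phi v.
Proof.
apply/eqP; rewrite -subr_eq0 -linearB; apply/eqP.
have : lspan S (qrepr (qproj S v) - v) by apply/qprojP; exact: qreprK.
by elim=> [|c s w /phiS s0 _ IH]; rewrite ?linear0 // linearP s0 IH scaler0 addr0.
Qed.

Lemma qlift_linear : linear qlift.
Proof.
by move=> c x y; rewrite -[x]qreprK -[y]qreprK -linearP !qlift_proj linearP.
Qed.
End QuotLift.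

Section TensorLift.
Variables (K : comNzRingType) (U V : lmodType K).
Implicit Types (a : U) (b : V).

Lemma tens_linearl b : linear (fun a => tens a b : tensor U V).
Proof.
move=> c a a'; transitivity (tens (c *: a) b + tens a' b : tensor U V).
  rewrite /tens -qprojD; apply/qprojP/lspan_gen; exact: tensorDl.
congr (_ + _); rewrite /tens -linearZ; apply/qprojP/lspan_gen; exact: tensorZl.
Qed.

Lemma tens_linearr a : linear (tens a : V -> tensor U V).
Proof.
move=> c b b'; transitivity (tens a (c *: b) + tens a b' : tensor U V).
  rewrite /tens -qprojD; apply/qprojP/lspan_gen; exact: tensorDr.
congr (_ + _); rewrite /tens -linearZ; apply/qprojP/lspan_gen; exact: tensorZr.
Qed.
HB.instance Definition _ a :=
  GRing.isLinear.Build K V (tensor U V) *:%R (tens a) (tens_linearr a).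

Lemma tensor_ind (Q : tensor U V -> Prop) :
    Q 0 -> (forall c x y, Q x -> Q y -> Q (c *: x + y)) ->
    (forall a b, Q (tens a b)) -> forall x, Q x.
Proof.
move=> Q0 QD Qt x; rewrite -[x]qreprK; move: (qrepr x) => {}x.
elim/malg_ind: x => [|c x y Qx Qy|[a b]]; last exact: Qt.
  by rewrite linear0.
by rewrite linearP; apply: QD.
Qed.

Variables (W : lmodType K) (beta : U -> V -> W).
Hypothesis beta_l : forall b, linear (beta^~ b).
Hypothesis beta_r : forall a, linear (beta a).

Fact tensor_lift_rel s :
  tensor_rel s -> malg_lift (fun p : U * V => beta p.1 p.2) s = 0.
Proof.
have betaDl a a' b : beta (a + a') b = beta a b + beta a' b.
  by rewrite -[a]scale1r beta_l !scale1r.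
have betaDr a b b' : beta a (b + b') = beta a b + beta a b'.
  by rewrite -[b]scale1r beta_r !scale1r.
have betaZl c a b := scalable_linear (beta_l b) c a.
have betaZr c a b := scalable_linear (beta_r a) c b.
case=> [a a' b|a b b'|c a b|c a b];
  rewrite linearB ?linearD ?linearZ /= !malg_liftU /=;
  by rewrite ?betaDl ?betaDr ?betaZl ?betaZr ?scalerN -?opprD subrr.
Qed.

Definition tensor_lift_fun : tensor U V -> W :=
  qlift (S := @tensor_rel K U V) (malg_lift (fun p : U * V => beta p.1 p.2)).

Definition tensor_lift : {linear tensor U V -> W} :=
  linear_of (qlift_linear tensor_lift_rel : linear tensor_lift_fun).

Lemma tensor_liftE a b : tensor_lift (tens a b) = beta a b.
Proof. by rewrite linear_ofE [LHS](qlift_proj tensor_lift_rel) [LHS]malg_liftU. Qed.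
End TensorLift.

Lemma freealg_ind (K : comNzRingType) (X : choiceType)
    (Q : freealg K X -> Prop) :
    Q 0 -> (forall c x y, Q x -> Q y -> Q (c *: x + y)) ->
    Q 1 -> (forall a x, Q x -> Q (fgen K a * x)) -> forall x, Q x.
Proof.
move=> Q0 QD Q1 QM; elim/malg_ind=> // w.
have [s ->] : exists s, w = FMonom s by case: w => s; exists s.
elim: s => [|a s IH].
  have -> : FMonom [::] = monalg.mone :> {fmonom X} by apply: val_inj; rewrite /= fm1.
  exact: Q1.
have -> : << FMonom (a :: s) >> = fgen K a * << FMonom s >> :> freealg K X.
  rewrite fgen.unlock malgM_def monalg.fgmulUU mulr1; congr << _ >>.
  by apply: val_inj; rewrite /= fmM fmU.
exact: QM.
Qed.

Section Eval.
Variables (K : comNzRingType) (X : choiceType) (W : lmodType K).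
Variable h : X -> lend W.

Definition eval : freealg K X -> lend W :=
  malg_lift (fun w : {fmonom X} => \prod_(a <- (w : seq X)) h a).
HB.instance Definition _ := GRing.Linear.on eval.

Lemma eval_gen a : eval (fgen K a) = h a.
Proof. by rewrite fgen.unlock /eval malg_liftU fmU big_seq1. Qed.

Fact eval_monoid : monoid_morphism eval.
Proof.
split=> [|x y].
  rewrite -[X in eval X]/(<< monalg.mone >> : freealg K X) /eval malg_liftU.
  by rewrite fm1 big_nil.
rewrite malgME linear_sum /= {2}/eval /malg_lift mulr_suml; apply: eq_bigr => w _.
rewrite linear_sum /= {2}/eval /malg_lift mulr_sumr; apply: eq_bigr => w' _ /=.
have E z k : << z *g k >> = z *: << k >> :> freealg K X.
  by apply/malgP=> l; rewrite monalg.mcoeffZ !mcoeffU mulrnAr mulr1.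
rewrite E linearZ /= /eval malg_liftU fmM big_cat /=.
by rewrite -lend_scalerAl -lend_scalerAr scalerA.
Qed.
HB.instance Definition _ := GRing.isMonoidMorphism.Build _ _ eval eval_monoid.

Lemma eval_mul x y p q : eval x = p -> eval y = q -> eval (x * y) = p * q.
Proof. by move=> <- <-; exact: rmorphM. Qed.

Lemma eval_opp x p : eval x = p -> eval (- x) = - p.
Proof. by move=> <-; exact: rmorphN. Qed.

Lemma eval_one : eval 1 = 1.
Proof. exact: rmorph1. Qed.
End Eval.

Section Action.
Variables (K : comNzRingType) (X : choiceType).
Variable rel : freealg K X -> freealg K X -> Prop.

Fact pproj_monoid : monoid_morphism (pproj rel).
Proof. by split=> [|x y]; [exact: pproj1 | exact: pprojM]. Qed.
HB.instance Definition _ :=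
  GRing.isMonoidMorphism.Build _ _ (pproj rel) pproj_monoid.

Lemma presalg_ind (Q : presalg rel -> Prop) :
    Q 0 -> (forall c x y, Q x -> Q y -> Q (c *: x + y)) ->
    Q 1 -> (forall a x, Q x -> Q (pgen rel a * x)) -> forall x, Q x.
Proof.
move=> Q0 QD Q1 QM x; rewrite -[x]preprK; move: (prepr x) => {}x.
elim/freealg_ind: x => [|c x y Qx Qy||a x Qx].
- by rewrite linear0.
- by rewrite linearP; apply: QD.
- by rewrite rmorph1.
- by rewrite rmorphM; apply: QM.
Qed.

(** Operators that satisfy the relations are the same as a module over the
    presented algebra; see act. *)
Definition sat (W : lmodType K) (h : X -> lend W) : Prop :=
  forall l r, rel l r -> eval h l = eval h r.

Variables (W : lmodType K) (h : X -> lend W).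
Hypothesis h_sat : sat h.

Fact eval_ideal s : ideal_gens rel s -> eval h s = 0.
Proof.
by case=> a [l [r [b [/h_sat e ->]]]]; rewrite !rmorphM rmorphB /= e subrr mulr0 mul0r.
Qed.

Definition act : {linear presalg rel -> lend W} :=
  linear_of (qlift_linear eval_ideal).

Lemma act_proj x : act (pproj rel x) = eval h x.
Proof. by rewrite linear_ofE; exact/qlift_proj/eval_ideal. Qed.

Lemma act1 : act 1 = 1.
Proof. by rewrite -pproj1 act_proj rmorph1. Qed.

Lemma actM x y : act (x * y) = act x * act y.
Proof. by rewrite -[x]preprK -[y]preprK -pprojM !act_proj rmorphM. Qed.

Lemma act_gen a : act (pgen rel a) = h a.
Proof. by rewrite act_proj eval_gen. Qed.
End Action.

(** * Tensor products and induced modules *)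

Section TensorProduct.
Variables (K : comNzRingType) (U V : lmodType K).

(** Tensor products up to isomorphism.  Induction on pure tensors replaces the
    uniqueness half of the universal property. *)
Record tensor_prod := TensorProd {
  tmod :> lmodType K;
  tpair : U -> V -> tmod;
  tpair_linearl : forall v, linear (tpair^~ v);
  tpair_linearr : forall u, linear (tpair u);
  tind : forall Q : tmod -> Prop,
    Q 0 -> (forall c x y, Q x -> Q y -> Q (c *: x + y)) ->
    (forall u v, Q (tpair u v)) -> forall x, Q x;
  tlift : forall (W : lmodType K) (beta : U -> V -> W),
    (forall v, linear (beta^~ v)) -> (forall u, linear (beta u)) ->
    {Psi : {linear tmod -> W} | forall u v, Psi (tpair u v) = beta u v}
}.

Lemma tensor_prod_lift_subproof (W : lmodType K) (beta : U -> V -> W) :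
    (forall v, linear (beta^~ v)) -> (forall u, linear (beta u)) ->
  {Psi : {linear GRing.Lmodule.clone K (tensor U V) _ -> W} |
    forall u v, Psi (tens u v) = beta u v}.
Proof.
by move=> linl linr; exists (tensor_lift linl linr); exact: tensor_liftE.
Qed.

Definition tensor_tensor_prod : tensor_prod :=
  @TensorProd (GRing.Lmodule.clone K (tensor U V) _) (@tens K U V)
    (@tens_linearl K U V) (@tens_linearr K U V) (@tensor_ind K U V)
    tensor_prod_lift_subproof.
End TensorProduct.

Section TensorOperators.
Variables (K : comNzRingType) (U V : lmodType K) (T : tensor_prod U V).

Fact lop_linl (p : lend U) v : linear (fun u => tpair T (p u) v).
Proof. by move=> c u u'; rewrite linearP; exact: tpair_linearl. Qed.
Fact lop_linr (p : lend U) u : linear (fun v => tpair T (p u) v).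
Proof. exact: tpair_linearr. Qed.
(** The operator p (x) id. *)
Definition lop (p : lend U) : lend T :=
  Lend (linearP (sval (tlift T (lop_linl p) (lop_linr p)))).

Lemma lopE p u v : lop p (tpair T u v) = tpair T (p u) v.
Proof. exact: (svalP (tlift T (lop_linl p) (lop_linr p))). Qed.

Variables (X : choiceType) (rel : freealg K X -> freealg K X -> Prop).

Lemma eval_lop (h : X -> lend U) x u v :
  eval (fun a => lop (h a)) x (tpair T u v) = tpair T (eval h x u) v.
Proof.
have lin := tpair_linearl T v.
elim/freealg_ind: x u => [|c x y IHx IHy||a x IH] u.
- rewrite !linear0; have := lin (-1) 0 0.
  by rewrite scaler0 addr0 scaleN1r addNr => /esym.
- by rewrite !linearP; have := lin c (eval h x u) (eval h y u); rewrite -IHx -IHy.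
- by rewrite !rmorph1.
- by rewrite !rmorphM !lendME /= !eval_gen IH lopE.
Qed.

Lemma lop_sat (h : X -> lend U) : sat rel h -> sat rel (fun a => lop (h a)).
Proof.
move=> hs l r lr; apply: lendP; elim/tind=> [|c x y IHx IHy|u v].
- by rewrite !linear0.
- by rewrite !linearP /= IHx IHy.
- by rewrite !eval_lop (hs _ _ lr).
Qed.
End TensorOperators.

Section Induced.
Variables (K : comNzRingType) (X : choiceType).
Variable rel : freealg K X -> freealg K X -> Prop.

(** The induced module A (x) B, where A is the algebra with relations rel, by
    its universal property; again induction stands for uniqueness.  With B the
    ground ring, this is the regular representation of A. *)
Record induced (B : lmodType K) := Induced {
  imod :> lmodType K;
  iin : {linear B -> imod};
  iop : X -> lend imod;
  iop_sat : sat rel iop;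
  iind : forall Q : imod -> Prop,
    Q 0 -> (forall c x y, Q x -> Q y -> Q (c *: x + y)) ->
    (forall b, Q (iin b)) -> (forall a m, Q m -> Q (iop a m)) -> forall m, Q m;
  ilift : forall (W : lmodType K) (h : X -> lend W) (phi : {linear B -> W}),
    sat rel h -> {Psi : {linear imod -> W} |
      (forall b, Psi (iin b) = phi b) & (forall a m, Psi (iop a m) = h a (Psi m))}
}.

Section InducedTensor.
Variables (U V : lmodType K) (N : induced U).
Variables (UV : tensor_prod U V) (M : tensor_prod N V).

Fact induced_tensor_linl v : linear (fun u => tpair M (iin N u) v).
Proof. by move=> c u u'; rewrite linearP; exact: tpair_linearl. Qed.
Fact induced_tensor_linr u : linear (fun v => tpair M (iin N u) v).
Proof. exact: tpair_linearr. Qed.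

(** The associativity isomorphism A (x) (U (x) V) = (A (x) U) (x) V restricted
    to 1 (x) (U (x) V). *)
Definition induced_tensor_in : {linear UV -> M} :=
  sval (tlift UV induced_tensor_linl induced_tensor_linr).

Lemma induced_tensor_inE u v :
  induced_tensor_in (tpair UV u v) = tpair M (iin N u) v.
Proof. exact: (svalP (tlift UV _ _)). Qed.

Lemma induced_tensor_ind (Q : M -> Prop) :
    Q 0 -> (forall c x y, Q x -> Q y -> Q (c *: x + y)) ->
    (forall b, Q (induced_tensor_in b)) ->
    (forall a m, Q m -> Q (lop M (iop N a) m)) -> forall m, Q m.
Proof.
move=> Q0 QD Q1 QM; elim/tind=> // n v; have lin := tpair_linearl M v.
elim/iind: n => [|c x y Qx Qy|u|a n Qn].
- have := lin (-1) 0 0.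
  by rewrite scaler0 addr0 scaleN1r addNr => ->.
- by rewrite [X in Q X]lin; exact: QD.
- by rewrite -induced_tensor_inE.
- by rewrite -lopE; exact: QM.
Qed.

(** For fixed v the lift exists on N by the universal property of N; these
    lifts depend linearly on v because they agree on generators. *)
Lemma induced_tensor_lift (W : lmodType K) (h : X -> lend W)
    (phi : {linear UV -> W}) :
  sat rel h -> {Psi : {linear M -> W} |
    (forall b, Psi (induced_tensor_in b) = phi b) &
    (forall a m, Psi (lop M (iop N a) m) = h a (Psi m))}.
Proof.
move=> hs.
have phi_lin v : linear (fun u => phi (tpair UV u v)).
  by move=> c u u'; have -> := tpair_linearl UV v c u u'; rewrite linearP.
have [psi psi1 psiM] : {psi : V -> {linear N -> W} |
    (forall v u, psi v (iin N u) = phi (tpair UV u v)) &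
    (forall v a n, psi v (iop N a n) = h a (psi v n))}.
  pose L v := ilift N (linear_of (phi_lin v)) hs.
  exists (fun v => s2val (L v)) => v *; last exact: (s2valP' (L v)).
  by rewrite (s2valP (L v)) linear_ofE.
have linl v : linear (psi v) by exact: linearP.
have linr n : linear (fun v => psi v n).
  move=> c v v' /=; elim/iind: n => [|d x y IHx IHy|u|a n IH].
  - by rewrite !linear0 addr0.
  - by rewrite 3!(linearP (psi _)) IHx IHy !scalerDr !scalerA addrACA [c * d]mulrC.
  - by rewrite !psi1 tpair_linearr linearP.
  - by rewrite !psiM IH linearP.
exists (sval (tlift M linl linr)) => [b|a m].
  elim/tind: b => [|c x y IHx IHy|u v].
  - by rewrite !linear0.
  - by rewrite !linearP /= IHx IHy.
  - rewrite induced_tensor_inE (svalP (tlift M linl linr)); exact: psi1.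
elim/tind: m => [|c x y IHx IHy|n v].
- by rewrite !linear0.
- by rewrite !linearP /= IHx IHy.
- rewrite lopE !(svalP (tlift M linl linr)); exact: psiM.
Qed.

(** Induction commutes with tensoring on the right.  With U the ground ring this
    says that A (x) V is induced from V; in general it regroups the threefold
    tensor product of the theorem. *)
Definition induced_tensor : induced UV :=
  Induced (lop_sat M (iop_sat N))
    induced_tensor_ind induced_tensor_lift.
End InducedTensor.

Lemma scale_linear (V : lmodType K) (v : V) : linear (fun c : K^o => c *: v).
Proof. by move=> c d e; rewrite scalerDl scalerA. Qed.

Lemma scalar_tensor_lift (V W : lmodType K) (beta : K^o -> V -> W) :
    (forall v, linear (beta^~ v)) -> (forall u, linear (beta u)) ->
  {Psi : {linear V -> W} | forall c v, Psi (c *: v) = beta c v}.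
Proof.
move=> linl linr; exists (linear_of (linr 1)) => c v.
rewrite linear_ofE (scalable_linear (linr 1)) -(scalable_linear (linl v)).
by rewrite [c *: _]mulr1.
Qed.

Lemma scalar_tensor_ind (V : lmodType K) (Q : V -> Prop) :
    Q 0 -> (forall c x y, Q x -> Q y -> Q (c *: x + y)) ->
  (forall (c : K^o) v, Q (c *: v)) -> forall x, Q x.
Proof. by move=> _ _ Q1 x; rewrite -[x]scale1r. Qed.

(** The identification of K (x) V with V. *)
Definition scalar_tensor_prod (V : lmodType K) : tensor_prod K^o V :=
  TensorProd (@scale_linear V) (fun c => linearP ( *:%R c))
    (@scalar_tensor_ind V) (@scalar_tensor_lift V).
End Induced.

Section Regular.
Variables (K : comNzRingType) (X : choiceType).
Variable rel : freealg K X -> freealg K X -> Prop.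
Local Notation A := (GRing.Lmodule.clone K (presalg rel) _).

Fact lmul_linear (x : presalg rel) : linear (fun y => x * y).
Proof. by move=> c y z; rewrite mulrDr -presalg_scalerAr. Qed.
Definition lmul x : lend A := Lend (lmul_linear x).
Lemma lmulE x y : lmul x y = x * y. Proof. by []. Qed.

Definition reg a := lmul (pgen rel a).

Lemma eval_reg x y : eval reg x y = pproj rel x * y.
Proof.
elim/freealg_ind: x y => [|c x x' IHx IHy||a x IH] y.
- by rewrite !linear0 mul0r.
- by rewrite !linearP mulrDl -presalg_scalerAl -IHx -IHy.
- by rewrite !rmorph1 mul1r.
- by rewrite !rmorphM lendME /= eval_gen IH lmulE mulrA.
Qed.

Lemma reg_sat : sat rel reg.
Proof. by move=> l r lr; apply: lendP => y; rewrite !eval_reg (pproj_rel lr). Qed.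

Definition reg_in : {linear K^o -> A} := linear_of (scale_linear (1 : A)).

Lemma reg_ind (Q : A -> Prop) :
    Q 0 -> (forall c x y, Q x -> Q y -> Q (c *: x + y)) ->
    (forall c, Q (reg_in c)) -> (forall a m, Q m -> Q (reg a m)) ->
  forall m, Q m.
Proof.
move=> Q0 QD Q1 QM; elim/presalg_ind=> [|c x y Qx Qy||a x Qx].
- exact: Q0.
- exact: QD.
- by have := Q1 1; rewrite linear_ofE scale1r.
- exact: (QM a).
Qed.

Lemma reg_lift (W : lmodType K) (h : X -> lend W) (phi : {linear K^o -> W}) :
  sat rel h -> {Psi : {linear A -> W} |
    (forall c, Psi (reg_in c) = phi c) & (forall a m, Psi (reg a m) = h a (Psi m))}.
Proof.
move=> hs.
have lin : linear (fun x : A => act hs x (phi 1)).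
  by move=> c x y; rewrite linearP.
have := linear_ofE lin; move: (linear_of lin) => Psi PsiE.
exists Psi => [c|a m].
  rewrite /reg_in (linear_ofE (scale_linear _)) linearZ PsiE act1.
  by rewrite lend1E -linearZ; congr (phi _); exact: mulr1.
by rewrite !PsiE lmulE actM act_gen lendME.
Qed.

Definition regular : induced rel K^o := Induced reg_sat reg_ind reg_lift.
End Regular.

(** * Brackets in the spin symmetric group algebra *)

Section AdjacentTranspositions.
Variable n : nat.

Lemma ltn_lo (k : 'I_n.-1) : (k < n)%N. Proof. by have := ltn_ord k; lia. Qed.
Lemma ltn_hi (k : 'I_n.-1) : (k.+1 < n)%N. Proof. by have := ltn_ord k; lia. Qed.
Definition lo k : 'I_n := Ordinal (ltn_lo k).
Definition hi k : 'I_n := Ordinal (ltn_hi k).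
Definition sw k : {perm 'I_n} := tperm (lo k) (hi k).

(** The action of sw k on the underlying numbers, for arithmetic. *)
Definition swn (k x : nat) : nat :=
  if x == k then k.+1 else if x == k.+1 then k else x.

Lemma sw_val k x : sw k x = swn k x :> nat.
Proof.
rewrite /swn; case: tpermP => [->|->|/eqP lx /eqP hx] /=.
- by rewrite eqxx.
- by rewrite eqxx; case: eqP => //; lia.
- by rewrite -!val_eqE /= in lx hx; rewrite (negbTE lx) (negbTE hx).
Qed.

Lemma swK k : involutive (sw k).
Proof. exact: tpermK. Qed.
End AdjacentTranspositions.

Section Bracket.
Variables (n : nat) (A : pzRingType) (t : 'I_n.-1 -> A).
Hypothesis spin : forall l r, spin_rel t l r -> l = r.

(** Generators indexed by numbers, with a junk value out of range. *)
Definition tn (k : nat) : A := oapp t 0 (insub k).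

Lemma tn_ord (k : 'I_n.-1) : tn k = t k.
Proof. by rewrite /tn insubT //= => k_lt; congr t; apply: val_inj. Qed.

Lemma tn_sq k : (k < n.-1)%N -> tn k * tn k = 1.
Proof. by move=> lk; rewrite -[k]/(val (Ordinal lk)) tn_ord; apply/spin/spin_sq. Qed.

Lemma tn_braid k : (k.+1 < n.-1)%N ->
  tn k * tn k.+1 * tn k = tn k.+1 * tn k * tn k.+1.
Proof.
move=> lk'; have lk := ltnW lk'.
rewrite -[k.+1]/(val (Ordinal lk')) -[k in tn k]/(val (Ordinal lk)) !tn_ord.
exact/spin/spin_braid.
Qed.

Lemma tn_far k l : (k < n.-1)%N -> (l < n.-1)%N -> (k.+1 < l)%N || (l.+1 < k)%N ->
  tn k * tn l = - (tn l * tn k).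
Proof.
move=> lk ll kl; rewrite -[k]/(val (Ordinal lk)) -[l]/(val (Ordinal ll)) !tn_ord.
exact/spin/spin_far.
Qed.

(** The bracket [i, i + d + 1], by peeling off its outermost generators: this
    recursion is the conjugation that the proofs use. *)
Fixpoint bn (i d : nat) : A :=
  if d is d'.+1 then - (tn (i + d) * bn i d' * tn (i + d)) else tn i.

Lemma bracket_ltE (i j : 'I_n) : (i < j)%N ->
  bracket_lt t i j = bn i (j - i).-1.
Proof.
move=> ij.
have prodE (s : seq 'I_n.-1) (P : pred nat) :
    \prod_(k <- s | P k) t k = \prod_(k <- filter P (map val s)) tn k.
  by rewrite big_filter big_map; apply: eq_bigr => k _; rewrite tn_ord.
have filterE a b : (b <= n.-1)%N ->
    [seq k <- iota 0 n.-1 | (a <= k < b)%N] = iota a (b - a).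
  move=> lb; apply: (irr_sorted_eq ltn_trans ltnn) => [||k].
  - by apply: (sorted_filter ltn_trans); exact: iota_ltn_sorted.
  - exact: iota_ltn_sorted.
  - by rewrite mem_filter !mem_iota; lia.
have ljn : (j <= n.-1)%N by have := ltn_ord j; lia.
rewrite /bracket_lt !(prodE _ (fun k => i < k < j)%N) !(prodE _ (fun k => i <= k < j)%N).
rewrite map_rev val_enum_ord filter_rev !filterE //.
have [d ->] : exists d, j = (i + d.+1)%N :> nat by exists (j - i).-1; lia.
have -> : (i + d.+1 - i.+1 = d)%N by lia.
rewrite addKn [d.+1.-1]/=.
elim: d => [|d IH].
  by rewrite big_nil big_seq1 mulr1 mul1r.
have iotaSr a b : iota a b.+1 = iota a b ++ [:: a + b]%N by rewrite -addn1 iotaD.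
rewrite [bn _ _]/= -IH 2!iotaSr rev_cat !big_cat !big_seq1 exprS mulN1r.
by rewrite addSnnS !mulNr !mulrA (commr_sign (tn _)).
Qed.

(** The inductive step along bn: x changes sign at both copies of the new
    outermost generator s and once more at b. *)
Fact anti_conj (x s b b' : A) : x * s = - (s * x) -> x * b = - (b' * x) ->
  x * - (s * b * s) = - (- (s * b' * s) * x).
Proof.
move=> xs xb; rewrite mulrN mulNr; congr (- _).
by rewrite !mulrA xs !mulNr -(mulrA s x) xb mulrN mulNr opprK -!mulrA xs !mulrN.
Qed.

Lemma bn_far i d k : (i + d < n.-1)%N -> (k < n.-1)%N ->
  (k.+1 < i)%N || (i + d.+1 < k)%N -> tn k * bn i d = - (bn i d * tn k).
Proof.
move=> ld lk; elim: d ld => [|d IH] ld kid /=; first by apply: tn_far; lia.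
by apply: anti_conj; [apply: tn_far | apply: IH]; lia.
Qed.

Lemma bn_top_up i d : (i + d.+1 < n.-1)%N ->
  tn (i + d.+1) * bn i d = - (bn i d.+1 * tn (i + d.+1)).
Proof.
by move=> ld /=; rewrite mulNr opprK -mulrA tn_sq // mulr1.
Qed.

Lemma bn_top_down i d : (i + d.+1 < n.-1)%N ->
  tn (i + d.+1) * bn i d.+1 = - (bn i d * tn (i + d.+1)).
Proof. by move=> ld /=; rewrite mulrN !mulrA tn_sq // mul1r. Qed.

Lemma bn_bot_up i d : (i + d.+1 < n.-1)%N ->
  tn i * bn i.+1 d = - (bn i d.+1 * tn i).
Proof.
elim: d => [|d IH] ld.
  rewrite /= mulNr opprK addn1 -tn_braid; last by lia.
  by rewrite -(mulrA _ _ (tn i)) tn_sq ?mulr1 //; lia.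
rewrite [bn i.+1 _]/= [bn i d.+2]/= addSnnS.
by apply: anti_conj; [apply: tn_far | apply: IH]; lia.
Qed.

(** Conjugate bn_bot_up by the generator and use that it squares to 1. *)
Lemma bn_bot_down i d : (i + d.+1 < n.-1)%N ->
  tn i * bn i d.+1 = - (bn i.+1 d * tn i).
Proof.
move=> ld; have sq : tn i * tn i = 1 by rewrite tn_sq //; lia.
have E : tn i * (tn i * bn i.+1 d) * tn i = tn i * - (bn i d.+1 * tn i) * tn i.
  by rewrite bn_bot_up.
rewrite mulrA sq mul1r mulrN mulNr -(mulrA (tn i)) -(mulrA _ (tn i)) sq mulr1 in E.
by rewrite E opprK.
Qed.

(** A generator strictly inside the bracket fixes both indices.  Below the top
    it passes the outermost generators; just below them, the braid relation
    turns it into the outer generator, which is far from the rest. *)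
Lemma bn_inside i d k : (i + d < n.-1)%N -> (i < k < i + d)%N ->
  tn k * bn i d = - (bn i d * tn k).
Proof.
elim/ltn_ind: d => -[|d] IH ld ikd; first by lia.
have [kd|kd] := ltnP k (i + d)%N.
  by apply: anti_conj; [apply: tn_far | apply: IH]; lia.
case: d => [|d] in IH ld ikd kd *; first by lia.
have -> : k = (i + d.+1)%N by lia.
set s := tn (i + d.+1); set s' := tn (i + d.+2); set b := bn i d.
(* The generator s is the last one below the outermost generator s'. *)
have br : s * s' * s = s' * s * s' by rewrite /s /s' [(i + d.+2)%N]addnS tn_braid //; lia.
have far : s' * b = - (b * s') by apply: bn_far; lia.
have -> : bn i d.+2 = s' * s * b * s * s'.
  by rewrite /= -/s -/s' -/b mulrN mulNr opprK !mulrA.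
have -> : s * (s' * s * b * s * s') = s' * s * (s' * b) * s * s'.
  by rewrite !mulrA br.
rewrite far mulrN !mulNr -!mulrA.
by congr (- (_ * (_ * (_ * _)))); rewrite !mulrA br.
Qed.

Definition brn (i j : nat) : A :=
  if (i < j)%N then bn i (j - i).-1 else - bn j (i - j).-1.

Lemma brnE (i j : 'I_n) : i != j -> bracket t i j = brn i j.
Proof.
rewrite -val_eqE /= => ij; rewrite /bracket /brn; case: ltnP => lij.
  by rewrite bracket_ltE.
by rewrite bracket_ltE //; lia.
Qed.

Lemma brn_conj_lt k i j : (k < n.-1)%N -> (i < j)%N -> (j <= n.-1)%N ->
  tn k * brn i j = - (brn (swn k i) (swn k j) * tn k).
Proof.
move=> lk ij lj; have [d ej] : exists d, j = (i + d.+1)%N by exists (j - i).-1; lia.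
subst j; rewrite /swn.
have brE a b : brn a (a + b.+1) = bn a b by rewrite /brn ifT ?addKn //; lia.
have brE' a b : brn (a + b.+1) a = - bn a b by rewrite /brn ifF ?addKn //; lia.
rewrite brE.
have [ei|ni] := eqVneq i k.
  subst i; case: d => [|d] in ij lj *.
    by rewrite addn1 eqxx ifF; [rewrite -addn1 brE' mulNr opprK | lia].
  have -> : (k + d.+2 == k) = false by lia.
  have -> : (k + d.+2 == k.+1) = false by lia.
  by rewrite -addSnnS brE bn_bot_down //; lia.
have [ei|ni'] := eqVneq i k.+1.
  subst i; have -> : (k.+1 + d.+1 == k) = false by lia.
  have -> : (k.+1 + d.+1 == k.+1) = false by lia.
  by rewrite addSnnS brE bn_bot_up //; lia.
have [ek|nk] := eqVneq (i + d.+1)%N k.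
  by rewrite -ek -addnS brE bn_top_up //; lia.
have [ek|nk'] := eqVneq (i + d.+1)%N k.+1.
  case: d => [|d] in ij lj ek nk *; first by lia.
  have -> : k = (i + d.+1)%N by lia.
  by rewrite brE bn_top_down //; lia.
rewrite brE; have [ik|ki] := ltnP i k; last by apply: bn_far; lia.
have [kd|dk] := ltnP k (i + d); first by apply: bn_inside; lia.
by apply: bn_far; lia.
Qed.

Lemma brnC i j : i != j -> brn j i = - brn i j.
Proof. by move=> ij; rewrite /brn; do 2 case: ltnP => ?; rewrite ?opprK //; exfalso; lia. Qed.

Lemma bracketC i j : i != j -> bracket t j i = - bracket t i j.
Proof. by move=> ij; rewrite (brnE ij) brnE 1?eq_sym // -brnC. Qed.

(** By antisymmetry i < j may be assumed.  The sign is the one by which distant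
    generators anticommute with a bracket; when k moves an endpoint, the factor
    (-1)^(j-i-1) in the bracket produces the same sign. *)
Lemma bracket_conj k i j : i != j ->
  t k * bracket t i j = - (bracket t (sw k i) (sw k j) * t k).
Proof.
move=> ij; rewrite !brnE ?(inj_eq perm_inj) // !sw_val -tn_ord.
have [lij|lji|/val_inj eij] := ltngtP i j; last by rewrite eij eqxx in ij.
  by apply: brn_conj_lt => //; have := ltn_ord j; lia.
have nij : (i : nat) != j by lia.
rewrite (brnC (i := j)) 1?eq_sym // mulrN brn_conj_lt //; last by have := ltn_ord i; lia.
have nij' : swn k j != swn k i by rewrite /swn; do !case: eqP; lia.
by rewrite (brnC nij') mulNr opprK.
Qed.

(** The map sg is the identity when z plays the role of y, and the opposite when
    it plays the role of xi.  As a bracket has an odd number of generators, sg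
    is applied an odd number of times, that is, once. *)
Section Move.
Variables (sg : A -> A) (z : 'I_n -> A).
Hypothesis sgK : involutive sg.
Hypothesis sgN : {morph sg : x / - x}.
Hypothesis sgMl : forall x y, sg x * y = sg (x * y).
Hypothesis sgMr : forall x y, x * sg y = sg (x * y).
Hypothesis tz : forall k i, t k * z i = sg (z (sw k i) * t k).

Lemma bn_move d (i j l : 'I_n) : j = (i + d.+1)%N :> nat ->
  bn i d * z l = sg (z (tperm i j l) * bn i d).
Proof.
elim: d i j l => [|d IH] i j l ej.
  have lk : (i < n.-1)%N by have := ltn_ord j; lia.
  pose k := Ordinal lk.
  have -> : i = lo k by apply: val_inj.
  have -> : j = hi k by apply: val_inj; rewrite /= ej; lia.
  by rewrite /= -[i : nat]/(val k) tn_ord tz.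
have lk : (i + d.+1 < n.-1)%N by have := ltn_ord j; lia.
pose k := Ordinal lk; have ej' : lo k = (i + d.+1)%N :> nat by [].
(* (i j) is the conjugate of (i j') by the last transposition (j' j), j' = j - 1 *)
have -> : tperm i j l = sw k (tperm i (lo k) (sw k l)).
  have -> : tperm i j = (tperm i (lo k) ^ sw k)%g.
    rewrite tpermJ {1}/sw tpermD -?val_eqE /=; [|lia..].
    by congr tperm; rewrite tpermL; apply: val_inj; rewrite /= ej; lia.
  by rewrite conjgE !permM /sw tpermV.
rewrite [bn i d.+1]/= -[(i + d.+1)%N]/(val k) tn_ord mulNr -mulrA tz.
rewrite sgMr mulrA -[_ * bn i d * _]mulrA (IH _ (lo k)) // sgMr sgMl sgK.
rewrite !mulrA tz !sgMl -!sgN; congr sg.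
by rewrite mulrN !mulrA.
Qed.

Lemma bracket_move i j l : i != j ->
  bracket t i j * z l = sg (z (tperm i j l) * bracket t i j).
Proof.
move=> ij; rewrite brnE // /brn; case: ltnP => lij; first by apply: bn_move; lia.
rewrite mulNr mulrN sgN tpermC; congr (- _); apply: bn_move.
by move: ij; rewrite -val_eqE /=; lia.
Qed.
End Move.

(** The commutator of y_i and xi_l is u times this element. *)
Definition comm_bracket (i l : 'I_n) : A :=
  if i == l then \sum_(k | k != i) bracket t i k else bracket t i l.
Local Notation c := comm_bracket.

Lemma comm_bracket_conj k i l : t k * c i l = - (c (sw k i) (sw k l) * t k).
Proof.
rewrite /c (inj_eq perm_inj); case: eqP => [_|/eqP]; last exact: bracket_conj.
rewrite mulr_sumr mulr_suml -sumrN (reindex_inj (@perm_inj _ (sw k))) /=.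
apply: eq_big => [m|m mi]; first by rewrite (can2_eq (swK k) (swK k)).
by rewrite bracket_conj ?swK // eq_sym.
Qed.

Section SkewJacobi.
Variable xi : 'I_n -> A.
Hypothesis txi : forall k i, t k * xi i = - (xi (sw k i) * t k).

Lemma bracket_xi i j l : i != j ->
  bracket t i j * xi l = - (xi (tperm i j l) * bracket t i j).
Proof.
exact: (bracket_move (sg := -%R) (@opprK _) (fun=> erefl) (@mulNr _) (@mulrN _) txi).
Qed.

(** Moving y_i through xi_j xi_l + xi_l xi_j, which is zero, leaves these four
    products.  Moving each bracket past its xi makes them cancel in pairs. *)
Lemma skew_jacobi i j l : j != l ->
  xi j * c i l + c i j * xi l + xi l * c i j + c i l * xi j = 0.
Proof.
wlog nil : j l / i != l => [W|] jl.
  have [eil|/W] := eqVneq i l; last exact.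
  have nij : i != j by rewrite eil eq_sym.
  have := W l j nij; rewrite eq_sym jl => /(_ isT) <-.
  by rewrite -[LHS]addrA [LHS]addrC addrA.
have cil : c i l = bracket t i l by rewrite /c (negbTE nil).
have [eij|nij] := eqVneq i j; last first.
  have -> : c i j = bracket t i j by rewrite /c (negbTE nij).
  rewrite cil !bracket_xi // !tpermD // 1?eq_sym //.
  by rewrite subrK addrN.
subst j; pose r := \sum_(k | (k != i) && (k != l)) bracket t i k.
have -> : c i i = bracket t i l + r by rewrite /c eqxx (bigD1 l) 1?eq_sym.
have rl : r * xi l = - (xi l * r).
  rewrite mulr_suml mulr_sumr -sumrN; apply: eq_bigr => k /andP[ki kl].
  by rewrite bracket_xi 1?eq_sym // tpermD // eq_sym.
rewrite cil mulrDl mulrDr rl !bracket_xi // tpermL tpermR.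
by rewrite addNKr addrCA addNr addr0 addrN.
Qed.
End SkewJacobi.

Section CommJacobi.
Variable y : 'I_n -> A.
Hypothesis ty : forall k i, t k * y i = y (sw k i) * t k.

Lemma bracket_y i j l : i != j ->
  bracket t i j * y l = y (tperm i j l) * bracket t i j.
Proof.
by apply: (bracket_move (sg := id)).
Qed.

(** When y_i y_j and y_j y_i are moved through xi_l, these are the terms in
    which exactly one commutator was taken.  They agree because [i,j] exchanges
    y_i and y_j and is antisymmetric. *)
Lemma comm_jacobi i j l :
  c i l * y j + y i * c j l = c j l * y i + y j * c i l.
Proof.
have [-> //|nij] := eqVneq i j.
wlog nil : i j nij / i != l => [W|].
  have [eil|nil] := eqVneq i l; last exact: W.
  have nji : j != i by rewrite eq_sym.
  by apply/esym/W; rewrite // -eil.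
have cil : c i l = bracket t i l by rewrite /c (negbTE nil).
have [ejl|njl] := eqVneq j l; last first.
  have -> : c j l = bracket t j l by rewrite /c (negbTE njl).
  by rewrite cil !bracket_y // !tpermD // 1?eq_sym // addrC.
subst l; pose r := \sum_(k | (k != j) && (k != i)) bracket t j k.
have -> : c j j = - bracket t i j + r.
  by rewrite /c eqxx (bigD1 i) //= (bracketC nij).
have ri : r * y i = y i * r.
  rewrite mulr_suml mulr_sumr; apply: eq_bigr => k /andP[kj ki].
  by rewrite bracket_y 1?eq_sym // tpermD // eq_sym.
rewrite cil mulrDl mulrDr ri mulNr mulrN !bracket_y // tpermL tpermR.
by rewrite addNKr addrAC addNr add0r.
Qed.
End CommJacobi.
End Bracket.

(** * Operators satisfying the defining relations *)

Section BracketTransport.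
Variables (n : nat) (A A' : pzRingType).

(** A bracket is a signed product of generators, so that every relation
    compatible with these operations passes to it. *)
Lemma bracket_rel (R : A -> A' -> Prop) (t : 'I_n.-1 -> A) (t' : 'I_n.-1 -> A') :
    R 1 1 -> (forall x x', R x x' -> R (- x) (- x')) ->
    (forall x x' y y', R x x' -> R y y' -> R (x * y) (x' * y')) ->
    (forall k, R (t k) (t' k)) ->
  forall i j, R (bracket t i j) (bracket t' i j).
Proof.
move=> R1 RN RM Rt; have Rlt i j : R (bracket_lt t i j) (bracket_lt t' i j).
  rewrite /bracket_lt; apply: (RM); [apply: (RM)|]; last exact: big_ind2.
    by elim: (_.-1) => [|d IH]; rewrite ?exprS //; apply/RM/IH/RN.
  exact: big_ind2.
by move=> i j; rewrite /bracket; case: ifP => _; [|apply: RN]; exact: Rlt.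
Qed.

Lemma bracket_morph (f : {rmorphism A -> A'}) (t : 'I_n.-1 -> A) i j :
  f (bracket t i j) = bracket (f \o t) i j.
Proof.
apply: (bracket_rel (R := fun x x' => f x = x')) => //.
- exact: rmorph1.
- by move=> x _ <-; rewrite rmorphN.
- by move=> x _ y _ <- <-; rewrite rmorphM.
Qed.
End BracketTransport.

Section Relations.
Variables (K : comNzRingType) (n : nat) (u : K).
Definition spinsym_rels := @spin_rel n (freealg K 'I_n.-1) (fgen K).
Definition skewpoly_rels := @skew_rel n (freealg K 'I_n) (fgen K).
Definition sdaha_rels := @sdaha_rel n K u (freealg K (sdaha_gen n))
    (fgen K \o @gen_xi n) (fgen K \o @gen_y n) (fgen K \o @gen_t n).

Variable W : lmodType K.

Fact eq_iff (T : Type) (x y p q : T) : x = p -> y = q -> x = y <-> p = q.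
Proof. by move=> -> ->. Qed.

Section Families.
Variables (X : choiceType) (h : X -> lend W).
Let eg := eval_gen h.

Lemma spin_evalP (g : 'I_n.-1 -> X) :
  (forall l r, spin_rel (fgen K \o g) l r -> eval h l = eval h r) <->
  (forall l r, spin_rel (h \o g) l r -> l = r).
Proof.
pose ev := fun k => eg (g k).
have sq i := eq_iff (eval_mul (ev i) (ev i)) (eval_one h).
have braid i j := eq_iff (eval_mul (eval_mul (ev i) (ev j)) (ev i))
  (eval_mul (eval_mul (ev j) (ev i)) (ev j)).
have far i j := eq_iff (eval_mul (ev i) (ev j)) (eval_opp (eval_mul (ev j) (ev i))).
split=> H _ _ [i|i j ij|i j ij].
- exact/(sq i).1/H/spin_sq.
- exact/(braid i j).1/H/spin_braid.
- exact/(far i j).1/H/spin_far.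
- exact/(sq i).2/H/spin_sq.
- exact/(braid i j).2/H/spin_braid.
- exact/(far i j).2/H/spin_far.
Qed.

Lemma skew_evalP (g : 'I_n -> X) :
  (forall l r, skew_rel (fgen K \o g) l r -> eval h l = eval h r) <->
  (forall i j, i != j -> h (g i) * h (g j) = - (h (g j) * h (g i))).
Proof.
pose ev := fun k => eg (g k).
have skew i j := eq_iff (eval_mul (ev i) (ev j)) (eval_opp (eval_mul (ev j) (ev i))).
split=> H; first by move=> i j ij; exact/(skew i j).1/H/skew_xi.
by move=> _ _ [i j ij]; exact/(skew i j).2/H.
Qed.
End Families.

Lemma spinsym_rels_sat (t : 'I_n.-1 -> lend W) :
  sat spinsym_rels t <-> (forall l r, spin_rel t l r -> l = r).
Proof. exact: (spin_evalP t id). Qed.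

Lemma skewpoly_rels_sat (xi : 'I_n -> lend W) :
  sat skewpoly_rels xi <-> (forall i j, i != j -> xi i * xi j = - (xi j * xi i)).
Proof. exact: (skew_evalP xi id). Qed.

(** The relations in the form in which they are used: the transpositions act on
    all indices by one rule, and so do the commutators. *)
Record sdaha_ops (xi y : 'I_n -> lend W) (t : 'I_n.-1 -> lend W) : Prop :=
  SdahaOps {
  ops_spin : forall l r, spin_rel t l r -> l = r;
  ops_skew : forall i j, i != j -> xi i * xi j = - (xi j * xi i);
  ops_yy : forall i j, y i * y j = y j * y i;
  ops_t_xi : forall k i, t k * xi i = - (xi (sw k i) * t k);
  ops_t_y : forall k i, t k * y i = y (sw k i) * t k;
  ops_y_xi : forall i l, y i * xi l = xi l * y i + u *: comm_bracket t i l
}.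

(** Of the two indices that t_k exchanges, the presentation treats only the
    lower one; the rule for the upper one follows on multiplying by t_k on both
    sides, as t_k squares to 1. *)
Lemma sdaha_rels_sat (h : sdaha_gen n -> lend W) :
  sat sdaha_rels h <-> sdaha_ops (h \o @gen_xi n) (h \o @gen_y n) (h \o @gen_t n).
Proof.
pose ex i := eval_gen h (gen_xi i); pose ey i := eval_gen h (gen_y i).
pose et k := eval_gen h (gen_t k).
have eb i j : eval h (bracket (fgen K \o @gen_t n) i j) = bracket (h \o @gen_t n) i j.
  rewrite bracket_morph; congr (bracket _ i j); apply: funext => k; exact: et.
have yy i j := eq_iff (eval_mul (ey i) (ey j)) (eval_mul (ey j) (ey i)).
have txi k i j := eq_iff (eval_mul (et k) (ex i)) (eval_opp (eval_mul (ex j) (et k))).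
have ty k i j := eq_iff (eval_mul (et k) (ey i)) (eval_mul (ey j) (et k)).
have eyx i l : eval h (fgen K (gen_y i) * fgen K (gen_xi l)
    - fgen K (gen_xi l) * fgen K (gen_y i)) =
    h (gen_y i) * h (gen_xi l) - h (gen_xi l) * h (gen_y i).
  rewrite linearB; congr (_ - _); exact: eval_mul.
have ebs i : eval h (u *: (\sum_(k | k != i) bracket (fgen K \o @gen_t n) i k))
    = u *: \sum_(k | k != i) bracket (h \o @gen_t n) i k.
  by rewrite linearZ linear_sum; congr (_ *: _); apply: eq_bigr => k _; exact: eb.
have ebz i j : eval h (u *: bracket (fgen K \o @gen_t n) i j)
    = u *: bracket (h \o @gen_t n) i j.
  by rewrite linearZ; congr (_ *: _); exact: eb.
have swl (k : 'I_n.-1) (i j : 'I_n) : i = k :> nat -> j = k.+1 :> nat -> sw k i = j.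
  by move=> ik jk; apply: val_inj; rewrite /= sw_val /swn ik eqxx jk.
have swd (k : 'I_n.-1) (i : 'I_n) : i != k :> nat -> i != k.+1 :> nat -> sw k i = i.
  by move=> ik jk; apply: val_inj; rewrite /= sw_val /swn (negbTE ik) (negbTE jk).
split=> [hs|[spin skew hyy htxi hty hyxi]]; last first.
  move=> l r; case=> {l r} [l r H|l r H|i j ij|k i j ik jk|k i j ik jk|k i ik jk|
    k i ik jk|i j ij|i].
  - by move: l r H; apply/spin_evalP.
  - by move: l r H; apply/skew_evalP; exact: skew.
  - by apply/(yy i j).2; exact: hyy.
  - by apply/(txi k i j).2; rewrite -(swl _ _ _ ik jk); exact: htxi.
  - by apply/(ty k i j).2; rewrite -(swl _ _ _ ik jk); exact: hty.
  - by apply/(txi k i i).2; rewrite -{2}(swd _ _ ik jk); exact: htxi.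
  - by apply/(ty k i i).2; rewrite -{2}(swd _ _ ik jk); exact: hty.
  - apply: (etrans (eyx i j) (etrans _ (esym (ebz i j)))).
    by have := hyxi i j; rewrite /comm_bracket (negbTE ij) /= => ->; rewrite addrAC addrN add0r.
  - apply: (etrans (eyx i i) (etrans _ (esym (ebs i)))).
    by have := hyxi i i; rewrite /comm_bracket eqxx /= => ->; rewrite addrAC addrN add0r.
have htxi (k : 'I_n.-1) (i j : 'I_n) : i = k :> nat -> j = k.+1 :> nat ->
    h (gen_t k) * h (gen_xi i) = - (h (gen_xi j) * h (gen_t k)).
  by move=> ik jk; exact/(txi k i j).1/hs/sdaha_t_xi.
have hty (k : 'I_n.-1) (i j : 'I_n) : i = k :> nat -> j = k.+1 :> nat ->
    h (gen_t k) * h (gen_y i) = h (gen_y j) * h (gen_t k).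
  by move=> ik jk; exact/(ty k i j).1/hs/sdaha_t_y.
have spin : forall l r, spin_rel (h \o @gen_t n) l r -> l = r.
  by apply/spin_evalP => l r lr; exact/hs/sdaha_spin.
have hsq k : h (gen_t k) * h (gen_t k) = 1 by exact/spin/spin_sq.
have sw_cases (k : 'I_n.-1) (i : 'I_n) (Q : 'I_n -> Prop) :
    (i = k :> nat -> forall j : 'I_n, j = k.+1 :> nat -> Q j) ->
    (i = k.+1 :> nat -> forall j : 'I_n, j = k :> nat -> Q j) ->
    (i != k :> nat -> i != k.+1 :> nat -> Q i) -> Q (sw k i).
  move=> Q1 Q2 Q3; have [ik|ik] := eqVneq (i : nat) k.
    by apply: Q1 => //; rewrite sw_val /swn ik eqxx.
  have [jk|jk] := eqVneq (i : nat) k.+1; last by rewrite swd //; exact: Q3.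
  by apply: Q2 => //; rewrite sw_val /swn jk eqxx; case: eqP => //; lia.
split=> //.
- by apply/(skew_evalP h (@gen_xi n)) => l r lr; exact/hs/sdaha_skew.
- move=> i j; have [-> //|ij] := eqVneq i j; exact/(yy i j).1/hs/sdaha_yy.
- move=> k i; apply: (sw_cases k i (fun j =>
      h (gen_t k) * h (gen_xi i) = - (h (gen_xi j) * h (gen_t k)))) => [ik j jk|ik j jk|ik jk].
  + exact: htxi.
  + have := congr1 (fun x => h (gen_t k) * x * h (gen_t k)) (htxi k j i jk ik).
    rewrite /= mulrA hsq mul1r mulrN mulNr -!mulrA hsq mulr1 => ->.
    by rewrite opprK.
  + exact/(txi k i i).1/hs/sdaha_t_xi_far.
- move=> k i; apply: (sw_cases k i (fun j =>
      h (gen_t k) * h (gen_y i) = h (gen_y j) * h (gen_t k))) => [ik j jk|ik j jk|ik jk].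
  + exact: hty.
  + have := congr1 (fun x => h (gen_t k) * x * h (gen_t k)) (hty k j i jk ik).
    by rewrite /= mulrA hsq mul1r -!mulrA hsq mulr1 => ->.
  + exact/(ty k i i).1/hs/sdaha_t_y_far.
- move=> i l; apply/eqP; rewrite addrC -subr_eq; apply/eqP.
  rewrite /comm_bracket; have [<-|il] := eqVneq i l.
    exact: (etrans (esym (eyx i i)) (etrans (hs _ _ (sdaha_y_xi _ _ _ _ i)) (ebs i))).
  exact: (etrans (esym (eyx i l)) (etrans (hs _ _ (sdaha_y_xi_neq _ _ _ _ il)) (ebz i l))).
Qed.
End Relations.

(** * The module structure on S (x) T (x) P *)

Section SwapRelations.
Variable n : nat.
Implicit Types (k l : 'I_n.-1) (i : 'I_n).

Lemma sw_braid k l i : l = k.+1 :> nat ->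
  sw k (sw l (sw k i)) = sw l (sw k (sw l i)).
Proof.
by move=> lk; apply: val_inj; rewrite /= !sw_val /swn lk; do !case: eqP => //; lia.
Qed.

Lemma sw_far k l i : (k.+1 < l)%N || (l.+1 < k)%N ->
  sw k (sw l i) = sw l (sw k i).
Proof.
by move=> kl; apply: val_inj; rewrite /= !sw_val /swn; do !case: eqP => //; lia.
Qed.
End SwapRelations.

Section InducedSpin.
Variables (K : comNzRingType) (n : nat).
Local Notation P := (GRing.Lmodule.clone K (mpoly n K) _).
Variable B : induced (@spinsym_rels K n) P.
Local Notation T := (iop B).

Let spinT : forall l r, spin_rel T l r -> l = r.
Proof. exact/spinsym_rels_sat/iop_sat. Qed.

Let F := GRing.Lmodule.clone K {ffun 'I_n -> B} _.

(** Functions from indices to B, on which t_k also permutes the indices, so that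
    the family of all y_i can be constructed at once. *)
Fact twist_linear k : linear (fun f : F => [ffun i => T k (f (sw k i))] : F).
Proof. by move=> c f g; apply/ffunP => i; rewrite !ffunE linearP. Qed.

Let twist k : lend F := Lend (twist_linear k).

Let twist_sat : sat (@spinsym_rels K n) twist.
Proof.
apply/spinsym_rels_sat => _ _ [k|k l kl|k l kl]; apply: lendP => f; apply/ffunP => i.
- by rewrite lendME !ffunE swK -lendME (spinT (spin_sq T k)).
- by rewrite !lendME !ffunE -!lendME (spinT (spin_braid T kl)) sw_braid.
- by rewrite lendNE !lendME !ffunE -!lendME (spinT (spin_far T kl)) lendNE (sw_far _ kl).
Qed.

Fact mulX_linear : linear (fun p : P => [ffun i => iin B ('X_i * p)] : F).
Proof.
by move=> c p q; apply/ffunP => i; rewrite !ffunE mulrDr -scalerAr linearP.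
Qed.

Lemma ex_y_spin : {y : 'I_n -> lend B | [/\
  forall i p, y i (iin B p) = iin B ('X_i * p),
  forall k i, T k * y i = y (sw k i) * T k &
  forall i j, y i * y j = y j * y i]}.
Proof.
have [Psi Psi1 PsiT] := ilift B (linear_of mulX_linear) twist_sat.
have lin i : linear (fun m => Psi m i) by move=> c m m'; rewrite linearP !ffunE.
pose y i : lend B := Lend (lin i).
have y1 i p : y i (iin B p) = iin B ('X_i * p).
  by rewrite /y /= Psi1 linear_ofE ffunE.
have yT i k m : y i (T k m) = T k (y (sw k i) m) by rewrite /y /= PsiT ffunE.
clearbody y; exists y; split=> // [k i|i j]; apply: lendP => m; first by rewrite !lendME yT swK.
rewrite !lendME; elim/iind: m i j => [|c m m' IH IH'|p|k m IH] i j.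
- by rewrite !linear0.
- by rewrite !linearP /= IH IH'.
- by rewrite !y1 mulrCA.
- by rewrite !yT IH.
Qed.
End InducedSpin.

Section InducedSkew.
Variables (K : comNzRingType) (n : nat) (u : K).
Variables (B : lmodType K) (tB : 'I_n.-1 -> lend B) (yB : 'I_n -> lend B).
Hypothesis spinB : forall l r, spin_rel tB l r -> l = r.
Hypothesis tyB : forall k i, tB k * yB i = yB (sw k i) * tB k.
Hypothesis yyB : forall i j, yB i * yB j = yB j * yB i.
Variable N : induced (@skewpoly_rels K n) B.
Local Notation xi := (iop N).

Let skew : forall i j, i != j -> xi i * xi j = - (xi j * xi i).
Proof. exact/skewpoly_rels_sat/iop_sat. Qed.

(** The operators - xi_(s_k i) anticommute like the xi_i, so that t_k is given by
    the universal property; the spin relations propagate from B to N because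
    both sides move past xi_i by the same permutation. *)
Lemma ex_t_skew : {t : 'I_n.-1 -> lend N | [/\
  forall k b, t k (iin N b) = iin N (tB k b),
  forall k i, t k * xi i = - (xi (sw k i) * t k) &
  forall l r, spin_rel t l r -> l = r]}.
Proof.
have sat_k k : sat (@skewpoly_rels K n) (fun i => - xi (sw k i)).
  apply/skewpoly_rels_sat => i j ij; rewrite !mulrNN skew ?opprK //.
  by rewrite (inj_eq perm_inj).
have lin k : linear (fun b => iin N (tB k b)).
  by move=> c b b'; rewrite !linearP.
pose L k := ilift N (linear_of (lin k)) (sat_k k).
pose t k : lend N := Lend (linearP (s2val (L k))).
have t1 k b : t k (iin N b) = iin N (tB k b).
  by rewrite /t /= (s2valP (L k)) linear_ofE.
have tx k i m : t k (xi i m) = - xi (sw k i) (t k m).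
  exact: (s2valP' (L k)).
move: t t1 tx => {L} t t1 tx; exists t; split=> // [k i|].
  by apply: lendP => m; rewrite lendNE !lendME tx.
have tN k m : t k (- m) = - t k m by exact: linearN.
move=> _ _ [k|k l kl|k l kl]; apply: lendP => m; rewrite ?lendNE !lendME ?lend1E.
- elim/iind: m => [|c m m' IH IH'|b|i m IH].
  + by rewrite !linear0.
  + by rewrite !linearP /= IH IH'.
  + by rewrite !t1 -lendME (spinB (spin_sq tB k)).
  + by rewrite tx tN tx IH swK opprK.
- elim/iind: m => [|c m m' IH IH'|b|i m IH].
  + by rewrite !linear0.
  + by rewrite !linearP /= IH IH'.
  + by rewrite !t1 -!lendME (spinB (spin_braid tB kl)).
  + by rewrite !(tx, tN) IH (sw_braid _ kl).
- elim/iind: m => [|c m m' IH IH'|b|i m IH].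
  + by rewrite !linear0.
  + by rewrite !linearP /= IH IH'.
  + by rewrite !t1 -!lendME (spinB (spin_far tB kl)) lendNE linearN.
  + by rewrite !(tx, tN) IH (sw_far _ kl) (linearN (xi _)).
Qed.

Variable t : 'I_n.-1 -> lend N.
Hypothesis t1 : forall k b, t k (iin N b) = iin N (tB k b).
Hypothesis txi : forall k i, t k * xi i = - (xi (sw k i) * t k).
Hypothesis spin : forall l r, spin_rel t l r -> l = r.
Local Notation c := (comm_bracket t).

Section Deform.
Variable i : 'I_n.
Let NN := GRing.Lmodule.clone K (N * N)%type _.

(** The rule y xi_j = xi_j y + u c_ij says that these operators map each pair
    (y m, m) to the pair of xi_j m; a map obeying the rule is thus the same as
    a module map into pairs. *)
Fact deform_linear j :
  linear (fun p : NN => (xi j p.1 + u *: c i j p.2, xi j p.2) : NN).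
Proof.
move=> d p q; congr (_, _); rewrite /= !linearP //.
by rewrite scalerDr addrACA -scalerDr.
Qed.

Let deform j : lend NN := Lend (deform_linear j).

Let deform_sat : sat (@skewpoly_rels K n) deform.
Proof.
apply/skewpoly_rels_sat => j l jl; apply: lendP => p; rewrite lendNE !lendME /deform /=.
congr (_, _); last by rewrite -!lendME skew.
have J : xi j (c i l p.2) + c i j (xi l p.2)
    = - (xi l (c i j p.2) + c i l (xi j p.2)).
  apply/eqP; rewrite -addr_eq0 addrA; apply/eqP.
  exact: (congr1 (fun f : lend N => f p.2) (skew_jacobi txi i jl)).
rewrite !linearD !linearZ /= -2!addrA -2!scalerDr J -opprD.
by congr (_ + _); rewrite -!lendME skew.
Qed.

Fact deform_in_linear : linear (fun b => (iin N (yB i b), iin N b) : NN).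
Proof. by move=> d b b'; congr (_, _); rewrite /= !linearP. Qed.

(** The second component of the lift is the identity, so that the first one
    obeys the commutation rule. *)
Lemma ex_deform : {y : lend N |
  (forall b, y (iin N b) = iin N (yB i b)) &
  (forall j, y * xi j = xi j * y + u *: c i j)}.
Proof.
have [Psi Psi1 PsiX] := ilift N (linear_of deform_in_linear) deform_sat.
have Psi2 m : (Psi m).2 = m.
  elim/iind: m => [|d m m' IH IH'|b|j m IH].
  - by rewrite linear0.
  - by rewrite linearP /= IH IH'.
  - by rewrite Psi1 linear_ofE.
  - by rewrite PsiX /= IH.
have lin : linear (fun m => (Psi m).1) by move=> d m m'; rewrite linearP.
exists (Lend lin) => [b|j]; first by rewrite /= Psi1 linear_ofE.
by apply: lendP => m; rewrite lendDE !lendME lendZE /= PsiX /= Psi2.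
Qed.
End Deform.

Lemma ex_y_skew : {y : 'I_n -> lend N |
  (forall i b, y i (iin N b) = iin N (yB i b)) & sdaha_ops u xi y t}.
Proof.
pose y i := s2val (ex_deform i).
have y1 i b : y i (iin N b) = iin N (yB i b) := s2valP (ex_deform i) b.
have yx i j : y i * xi j = xi j * y i + u *: c i j := s2valP' (ex_deform i) j.
clearbody y.
have yxm i j m : y i (xi j m) = xi j (y i m) + u *: c i j m.
  by rewrite -lendME yx lendDE.
have ty k i : t k * y i = y (sw k i) * t k.
  apply: lendP => m; rewrite !lendME; elim/iind: m => [|d m m' IH IH'|b|j m IH].
  - by rewrite !linear0.
  - by rewrite !linearP /= IH IH'.
  - by rewrite y1 !t1 y1 -[in LHS]lendME tyB.
  - have txm j' m' : t k (xi j' m') = - xi (sw k j') (t k m').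
      by rewrite -lendME txi.
    have cm : t k (c i j m) = - c (sw k i) (sw k j) (t k m).
      by rewrite -lendME comm_bracket_conj.
    by rewrite yxm linearD linearZ /= !txm IH cm (linearN (y _)) /= yxm opprD scalerN.
exists y => //; split=> // i j; apply: lendP => m; rewrite !lendME.
elim/iind: m => [|d m m' IH IH'|b|l m IH].
- by rewrite !linear0.
- by rewrite !linearP /= IH IH'.
- by rewrite !y1 -[in LHS]lendME yyB.
rewrite !yxm !linearD !linearZ /= !yxm IH -2!addrA -2!scalerDr.
congr (_ + u *: _).
exact: (congr1 (fun f : lend N => f m) (comm_jacobi ty i j l)).
Qed.
End InducedSkew.

(** * The isomorphism *)

Section PolynomialAction.
Variables (K : comNzRingType) (n : nat) (W : lmodType K).
Variables (y : 'I_n -> lend W) (w : W).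
Local Notation P := (GRing.Lmodule.clone K (mpoly n K) _).

Definition monop (m : mpoly.multinom n) : lend W := \prod_(i < n) y i ^+ m i.

Definition polyev (g : P) : W := \sum_(m <- msupp g) g@_m *: monop m w.

(** A common finite range of monomials for all polynomials of bounded degree, to
    compare evaluations of different polynomials. *)
Lemma polyevEw k (g : P) : (msize g <= k)%N ->
  polyev g = \sum_(m : 'X_{1..n < k}) g@_m *: monop m w.
Proof.
move=> gk; rewrite /polyev (ssrcomplements.big_mksub 'X_{1..n < k}) ?msupp_uniq //=.
  by rewrite big_rmcond //= => m /memN_msupp_eq0 ->; rewrite scale0r.
by move=> m /msize_mdeg_lt /leq_trans; apply.
Qed.

Lemma polyev_linear : linear polyev.
Proof.
move=> c f g; pose k := maxn (msize (c *: f + g)) (maxn (msize f) (msize g)).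
rewrite !(@polyevEw k) ?leq_max ?leqnn ?orbT //.
rewrite scaler_sumr -big_split; apply: eq_bigr => m _.
by rewrite mcoeffD mcoeffZ scalerDl scalerA.
Qed.

Lemma polyevX m : polyev 'X_[m] = monop m w.
Proof. by rewrite /polyev msuppX big_seq1 mcoeffX eqxx scale1r. Qed.

Lemma mpoly_ext (f g : {linear P -> W}) : (forall m, f 'X_[m] = g 'X_[m]) -> f =1 g.
Proof.
move=> fg p; rewrite [p]mpolyE !linear_sum; apply: eq_bigr => m _.
by rewrite !linearZ /= fg.
Qed.

Hypothesis yy : forall i j, y i * y j = y j * y i.

Lemma monopU i m : monop (U_(i) + m) = y i * monop m.
Proof.
have ->: monop (U_(i) + m) = \prod_(j < n) (y j ^+ (i == j) * y j ^+ m j).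
  by apply: eq_bigr => j _; rewrite mnmDE mnm1E exprD.
rewrite GRing.prodrM_comm; last first.
  by move=> a b _ _; apply/commrX/commr_sym/commrX/yy.
congr (_ * _).
have -> : \prod_(j < n) y j ^+ (i == j) = \prod_(j < n | j == i) y j.
  by rewrite [RHS]big_mkcond; apply: eq_bigr => j _; rewrite eq_sym; case: eqP.
exact: big_pred1.
Qed.

Lemma polyev_mulX i g : polyev ('X_i * g) = y i (polyev g).
Proof.
have lin1 : linear (fun g : P => polyev ('X_i * g)).
  by move=> c p q; rewrite mulrDr -scalerAr polyev_linear.
have lin2 : linear (fun g : P => y i (polyev g)).
  by move=> c p q; rewrite polyev_linear linearP.
rewrite -(linear_ofE lin1) -(linear_ofE lin2); move: g; apply: mpoly_ext => m.
by rewrite !linear_ofE -mpolyXD !polyevX monopU.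
Qed.
End PolynomialAction.

Section AbstractPBW.
Variables (K : comNzRingType) (n : nat) (u : K).
Local Notation P := (GRing.Lmodule.clone K (mpoly n K) _).
Variables (B : induced (@spinsym_rels K n) P) (N : induced (@skewpoly_rels K n) B).
Variable H : induced (@sdaha_rels K n u) K^o.

Let hxi i := iop H (gen_xi i).
Let hy i := iop H (gen_y i).
Let ht k := iop H (gen_t k).
Let one := iin H 1.
Let opsH : sdaha_ops u hxi hy ht := (sdaha_rels_sat u (iop H)).1 (iop_sat H).

(** The multiplication map mu and the orbit map nu of the vector 1 (x) 1 (x) 1
    commute with all generators, which makes them inverse to each other. *)
Lemma pbw_iso : {mu : {linear N -> H} | bijective mu & [/\
  forall i m, mu (iop N i m) = hxi i (mu m),
  forall k b, mu (iin N (iop B k b)) = ht k (mu (iin N b)) &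
  forall g, mu (iin N (iin B g)) = polyev hy one g]}.
Proof.
case: opsH => spinH skewH yyH txiH tyH yxH.
have [yB [yB1 tyB yyB]] := ex_y_spin B.
have spinB := (spinsym_rels_sat (iop B)).1 (iop_sat B).
have [t [t1 txi spin]] := ex_t_skew spinB N.
have [y y1 opsN] := ex_y_skew u tyB yyB t1 txi spin.
pose hN (a : sdaha_gen n) : lend N :=
  match a with inl (inl i) => iop N i | inl (inr i) => y i | inr k => t k end.
have satN : sat (@sdaha_rels K n u) hN by apply/sdaha_rels_sat; exact: opsN.
have [nu nu1 nuM] :=
  ilift H (linear_of (scale_linear (iin N (iin B 1)))) satN.
have satT : sat (@spinsym_rels K n) ht by exact/spinsym_rels_sat.
have satS : sat (@skewpoly_rels K n) hxi by exact/skewpoly_rels_sat.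
have [muB muB1 muBt] := ilift B (linear_of (polyev_linear hy one)) satT.
have [mu mu1 muxi] := ilift N muB satS.
have muBy i b : muB (yB i b) = hy i (muB b).
  elim/iind: b i => [|c b b' IH IH'|g|k b IH] i.
  - by rewrite !linear0.
  - by rewrite !linearP /= IH IH'.
  - by rewrite yB1 !muB1 !linear_ofE polyev_mulX.
  - have -> : yB i (iop B k b) = iop B k (yB (sw k i) b).
      by rewrite -!lendME tyB swK.
    by rewrite !muBt IH -!lendME tyH swK.
have txim k i m : t k (iop N i m) = - iop N (sw k i) (t k m).
  by rewrite -lendME txi.
have mut k m : mu (t k m) = ht k (mu m).
  elim/iind: m => [|c m m' IH IH'|b|i m IH].
  - by rewrite !linear0.
  - by rewrite !linearP /= IH IH'.
  - by rewrite t1 !mu1 muBt.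
  - by rewrite txim linearN !muxi IH -!lendME txiH.
have muc i l m : mu (comm_bracket t i l m) = comm_bracket ht i l (mu m).
  have mub j k m' : mu (bracket t j k m') = bracket ht j k (mu m').
    move: m'; apply: (bracket_rel (R := fun (f : lend N) (g : lend H) =>
      forall m', mu (f m') = g (mu m'))) => //.
    - by move=> f g fg m'; rewrite !lendNE linearN fg.
    - by move=> f f' g g' ff gg m'; rewrite !lendME ff gg.
  have lsum (V : lmodType K) (I : finType) (Q : pred I) (F : I -> lend V) v :
      (\sum_(k | Q k) F k) v = \sum_(k | Q k) F k v.
    by elim/big_rec2: _ => // k f g _ <-.
  rewrite /comm_bracket; case: ifP => _; last exact: mub.
  by rewrite !lsum linear_sum; apply: eq_bigr => k _; exact: mub.
have muy i m : mu (y i m) = hy i (mu m).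
  elim/iind: m i => [|c m m' IH IH'|b|l m IH] i.
  - by rewrite !linear0.
  - by rewrite !linearP /= IH IH'.
  - by rewrite y1 !mu1 muBy.
  - have -> : y i (iop N l m) = iop N l (y i m) + u *: comm_bracket t i l m.
      by rewrite -lendME (ops_y_xi opsN).
    rewrite linearD linearZ /= !muxi IH muc -[RHS]lendME yxH.
    by [].
have munu x : mu (nu x) = x.
  elim/iind: x => [|c x x' IH IH'|c|a x IH].
  - by rewrite !linear0.
  - by rewrite !linearP /= IH IH'.
  - rewrite nu1 linear_ofE linearZ /= mu1 muB1 linear_ofE.
    have -> : polyev hy one 1 = one.
      by rewrite -mpolyX0 polyevX /monop big1 // => i _; rewrite mnm0E.
    by rewrite /one -linearZ; congr (iin H _); exact: mulr1.
  - by rewrite nuM; case: a => [[i|i]|k] /=; rewrite ?muxi ?muy ?mut IH.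
have nupoly g : nu (polyev hy one g) = iin N (iin B g).
  have lin1 : linear (fun g : P => nu (polyev hy one g)).
    by move=> c p q; rewrite polyev_linear linearP.
  have lin2 : linear (fun g : P => iin N (iin B g)).
    by move=> c p q; rewrite !linearP.
  rewrite -(linear_ofE lin1) -(linear_ofE lin2); move: g; apply: mpoly_ext => m.
  rewrite !linear_ofE polyevX mpolyXE_id /monop.
  have nuone : nu one = iin N (iin B 1) by rewrite nu1 linear_ofE scale1r.
  suff E (s : seq 'I_n) : nu ((\prod_(i <- s) hy i ^+ m i) one)
      = iin N (iin B (\prod_(i <- s) 'X_i ^+ m i)) by exact: E.
  elim: s => [|i s IH]; first by rewrite !big_nil lend1E.
  rewrite !big_cons lendME; elim: (m i) => [|d IHd].
    by rewrite !expr0 mul1r lend1E.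
  rewrite !exprS lendME nuM /= IHd y1 yB1 mulrA.
  by [].
have numu m : nu (mu m) = m.
  elim/iind: m => [|c m m' IH IH'|b|i m IH].
  - by rewrite !linear0.
  - by rewrite !linearP /= IH IH'.
  - rewrite mu1; elim/iind: b => [|c b b' IH IH'|g|k b IH].
    + by rewrite !linear0.
    + by rewrite !linearP /= IH IH'.
    + by rewrite muB1 linear_ofE nupoly.
    + by rewrite muBt nuM /= IH t1.
  - by rewrite muxi nuM /= IH.
exists mu; first by exists nu.
by split=> [i m|k b|g]; rewrite ?mu1 ?muxi ?muBt // muB1 linear_ofE.
Qed.
End AbstractPBW.

Section TensorPBW.
Variables (K : comNzRingType) (n : nat) (u : K).
Local Notation P := (GRing.Lmodule.clone K (mpoly n K) _).
Variables (S : induced (@skewpoly_rels K n) K^o) (T : induced (@spinsym_rels K n) K^o).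
Variable H : induced (@sdaha_rels K n u) K^o.
Variables (ST : tensor_prod S T) (TP : tensor_prod T P) (M : tensor_prod ST P).

Let B : induced (@spinsym_rels K n) P := induced_tensor (scalar_tensor_prod P) TP.
Let N0 : induced (@skewpoly_rels K n) T := induced_tensor (scalar_tensor_prod T) ST.
Let N : induced (@skewpoly_rels K n) TP := induced_tensor (N := N0) TP M.

Fact pure_iin s g : tpair M (tpair ST (iin S 1) s) g = iin N (tpair TP s g).
Proof.
rewrite [RHS]induced_tensor_inE; congr (tpair M _ g).
rewrite -[in RHS](scale1r s); apply: esym.
exact: (induced_tensor_inE (scalar_tensor_prod T) ST (1 : K^o) s).
Qed.

Fact pure_poly g : tpair TP (iin T 1) g = iin B g.
Proof.
rewrite -[in RHS](scale1r g); apply: esym.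
exact: (induced_tensor_inE (scalar_tensor_prod P) TP (1 : K^o) g).
Qed.

(** The family G is the expected formula on pure tensors; mu agrees with it as
    soon as G obeys the same rules, by induction on f and then, for f = 1, on
    s. *)
Theorem pbw_tensor : {mu : {linear M -> H} | bijective mu &
  forall G : S -> T -> P -> H,
    (forall s g, linear (fun f => G f s g)) ->
    (forall g, linear (fun s => G (iin S 1) s g)) ->
    (forall i f s g, G (iop S i f) s g = iop H (gen_xi i) (G f s g)) ->
    (forall k s g, G (iin S 1) (iop T k s) g
                   = iop H (gen_t k) (G (iin S 1) s g)) ->
    (forall g, G (iin S 1) (iin T 1) g
               = polyev (fun i => iop H (gen_y i)) (iin H 1) g) ->
  forall f s g, mu (tpair M (tpair ST f s) g) = G f s g}.
Proof.
have [mu bij_mu [muxi mut mup]] := pbw_iso (B := B) N H.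
exists mu => // G linf lins Gxi Gt Gp f s g.
have iin1 X (rel : freealg K X -> freealg K X -> Prop) (I : induced rel K^o) c :
    iin I c = c *: iin I 1.
  by rewrite -linearZ; congr (iin I _); exact/esym/mulr1.
have lin0 (V W : lmodType K) (psi : V -> W) : linear psi -> psi 0 = 0.
  by move=> /(_ (-1) 0 0); rewrite scaler0 addr0 scaleN1r addNr.
have base c g' : linear (fun s => tpair M (tpair ST c s) g').
  by move=> d a b; rewrite tpair_linearr; exact: (tpair_linearl M).
have basel s' g' : linear (fun f => tpair M (tpair ST f s') g').
  by move=> d a b; rewrite [X in tpair M X]tpair_linearl; exact: (tpair_linearl M).
elim/iind: f => [|c f f' IH IH'|c|i f IH].
- by rewrite (lin0 _ _ _ (basel s g)) linear0 (lin0 _ _ _ (linf s g)).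
- by rewrite (basel s g) linearP IH IH' (linf s g).
- rewrite iin1 (scalable_linear (basel s g)) linearZ (scalable_linear (linf s g)).
  congr (c *: _).
  elim/iind: s => [|d s s' IH IH'|d|k s IH].
  + by rewrite (lin0 _ _ _ (base _ g)) linear0 (lin0 _ _ _ (lins g)).
  + by rewrite (base _ g) linearP IH IH' (lins g).
  + rewrite (iin1 _ _ T d) (scalable_linear (base _ g)) linearZ (scalable_linear (lins g)).
    by congr (d *: _); rewrite Gp pure_iin pure_poly mup.
  + rewrite pure_iin Gt -IH pure_iin -mut; congr (mu (iin N _)); exact/esym/lopE.
rewrite Gxi -IH -muxi; congr (mu _).
by rewrite -[tpair ST _ _]lopE; exact/esym/lopE.
Qed.
End TensorPBW.

(** * Skew polynomials, the spin algebra and the Hecke algebra as quotients *)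

Section NamedRegular.
Variables (K : comNzRingType) (n : nat) (u : K).
(** The regular representations again, on the named types: this keeps the
    comparison of the structures on the iterated tensor product shallow. *)
Definition skewpoly_regular : induced (@skewpoly_rels K n) K^o :=
  let r := regular (@skewpoly_rels K n) in
  @Induced _ _ _ _ (GRing.Lmodule.clone K (skewpoly K n) _) (iin r) (iop r)
    (iop_sat r) (@iind _ _ _ _ r) (@ilift _ _ _ _ r).
Definition spinsym_regular : induced (@spinsym_rels K n) K^o :=
  let r := regular (@spinsym_rels K n) in
  @Induced _ _ _ _ (GRing.Lmodule.clone K (spinsym K n) _) (iin r) (iop r)
    (iop_sat r) (@iind _ _ _ _ r) (@ilift _ _ _ _ r).
Definition sdaha_regular : induced (@sdaha_rels K n u) K^o :=
  let r := regular (@sdaha_rels K n u) in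
  @Induced _ _ _ _ (GRing.Lmodule.clone K (sdaha n u) _) (iin r) (iop r)
    (iop_sat r) (@iind _ _ _ _ r) (@ilift _ _ _ _ r).
End NamedRegular.

Section RegularOperators.
Variables (K : comNzRingType) (X : choiceType).
Variable rel : freealg K X -> freealg K X -> Prop.

Lemma reg_in1 : reg_in rel 1 = 1.
Proof. by rewrite /reg_in linear_ofE scale1r. Qed.

Lemma reg_expE a d x : (reg rel a ^+ d) x = pgen rel a ^+ d * x.
Proof.
elim: d => [|d IH]; first by rewrite !expr0 lend1E mul1r.
rewrite (exprS (reg rel a)) (exprS (pgen rel a)) lendME IH; exact: mulrA.
Qed.

Lemma reg_monop n (a : 'I_n -> X) (m : mpoly.multinom n) :
  monop (fun i => reg rel (a i)) m 1 = \prod_(i < n) pgen rel (a i) ^+ m i.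
Proof.
rewrite /monop; elim: (index_enum _) => [|i s IH].
  by rewrite !big_nil lend1E.
by rewrite !big_cons lendME IH reg_expE.
Qed.
End RegularOperators.

Section Main.
Variables (K : comNzRingType) (n : nat) (u : K).

Lemma polyev_poly_in (g : mpoly n K) :
  polyev (fun i => reg _ (gen_y i)) (1 : sdaha n u) g = poly_in u g.
Proof. by apply: eq_bigr => m _; congr (_ *: _); exact: reg_monop. Qed.

Let S := skewpoly_regular K n.
Let T := spinsym_regular K n.
Let H := sdaha_regular n u.

Let G (f : S) (s : T) (g : mpoly n K) : H :=
  skewpoly_in u f * spinsym_in u s * poly_in u g.

Lemma mul_linear_l (x y : sdaha n u) c (a b : sdaha n u) :
  (c *: a + b) * x * y = c *: (a * x * y) + b * x * y.
Proof. by rewrite !mulrDl -!presalg_scalerAl. Qed.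

Lemma mul_linear_m (x y : sdaha n u) c (a b : sdaha n u) :
  x * (c *: a + b) * y = c *: (x * a * y) + x * b * y.
Proof. by rewrite mulrDr mulrDl -presalg_scalerAr -presalg_scalerAl. Qed.

Fact G_linf s g : linear (fun f => G f s g).
Proof.
move=> c f f'.
have E := skewpoly_in_linear u c f f'.
exact: (etrans (congr1 (fun z => z * spinsym_in u s * poly_in u g) E)
  (mul_linear_l (spinsym_in u s) (poly_in u g) c (skewpoly_in u f) (skewpoly_in u f'))).
Qed.

Fact G_lins f g : linear (fun s => G f s g).
Proof.
move=> c s s'.
have E := spinsym_in_linear u c s s'.
exact: (etrans (congr1 (fun z => skewpoly_in u f * z * poly_in u g) E)
  (mul_linear_m (skewpoly_in u f) (poly_in u g) c (spinsym_in u s) (spinsym_in u s'))).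
Qed.

Fact G_xi i f s g : G (iop S i f) s g = iop H (gen_xi i) (G f s g).
Proof.
have E : skewpoly_in u (iop S i f) = sdaha_xi u i * skewpoly_in u f.
  exact: (etrans (skewpoly_inM u _ f) (congr1 ( *%R^~ _) (skewpoly_in_gen u i))).
have assoc (A : pzRingType) (a b c d : A) : a * b * c * d = a * (b * c * d).
  by rewrite !mulrA.
exact: (etrans (congr1 (fun z => z * spinsym_in u s * poly_in u g) E)
  (assoc _ _ _ _ _)).
Qed.

Let skew1 : skewpoly_in u (iin S 1) = 1.
Proof.
have E : iin S 1 = 1 :> skewpoly K n by exact: (reg_in1 (@skewpoly_rels K n)).
exact: (etrans (congr1 (skewpoly_in u) E) (skewpoly_in1 n u)).
Qed.

Let spin1 : spinsym_in u (iin T 1) = 1.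
Proof.
have E : iin T 1 = 1 :> spinsym K n by exact: (reg_in1 (@spinsym_rels K n)).
exact: (etrans (congr1 (spinsym_in u) E) (spinsym_in1 n u)).
Qed.

Let G1 s g : G (iin S 1) s g = spinsym_in u s * poly_in u g.
Proof.
have unit_l (a b : sdaha n u) : 1 * a * b = a * b by rewrite mul1r.
exact: (etrans (congr1 (fun z => z * spinsym_in u s * poly_in u g) skew1)
  (unit_l _ _)).
Qed.

Fact G_t k s g : G (iin S 1) (iop T k s) g = iop H (gen_t k) (G (iin S 1) s g).
Proof.
have E : spinsym_in u (iop T k s) = sdaha_t u k * spinsym_in u s.
  exact: (etrans (spinsym_inM u _ s) (congr1 ( *%R^~ _) (spinsym_in_gen u k))).
have assoc (a b c : sdaha n u) : a * b * c = a * (b * c) := esym (mulrA a b c).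
apply: (etrans (G1 _ g) (etrans (congr1 ( *%R^~ (poly_in u g)) E) _)).
exact: (etrans (assoc _ _ _) (congr1 ( *%R (sdaha_t u k)) (esym (G1 s g)))).
Qed.

Fact G_y g : G (iin S 1) (iin T 1) g
  = polyev (fun i => iop H (gen_y i)) (iin H 1) g.
Proof.
have unit_l (a : sdaha n u) : 1 * a = a by rewrite mul1r.
apply: (etrans (G1 _ g) (etrans (congr1 ( *%R^~ (poly_in u g)) spin1) _)).
apply: (etrans (unit_l _) (etrans (esym (polyev_poly_in g)) _)).
exact: (congr1 (fun z => polyev _ z g) (esym (reg_in1 _))).
Qed.

Let U0 := GRing.Lmodule.clone K
  (tensor (tensor (skewpoly K n) (spinsym K n)) (mpoly n K)) _.
Let V0 := GRing.Lmodule.clone K (sdaha n u) _.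

Fact pbw_sig : {mu : {linear U0 -> V0} | bijective mu &
  forall f s g, mu (tens (tens f s) g) = G f s g}.
Proof.
have [mu bij_mu muE] := pbw_tensor H (tensor_tensor_prod T _)
  (tensor_tensor_prod (tensor_tensor_prod S T) _).
have := muE G G_linf (G_lins _) G_xi G_t G_y.
move: {muE} mu bij_mu.
(* The two descriptions of the modules agree by unfolding; abstracting over the
   modules lets them be compared as a whole. *)
pose goal (U V : lmodType K) (pt : S -> T -> mpoly n K -> U)
    (G' : S -> T -> mpoly n K -> V) :=
  forall mu : {linear U -> V}, bijective mu ->
    (forall f s g, mu (pt f s g) = G' f s g) ->
    {mu : {linear U -> V} | bijective mu & forall f s g, mu (pt f s g) = G' f s g}.
have key U V pt G' : goal U V pt G' by move=> mu; exists mu.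
exact: (key U0 V0 (fun f s g => tens (tens f s) g) G).
Qed.

Theorem pbw :
  exists mult : {linear tensor (tensor (skewpoly K n) (spinsym K n))
                               (mpoly n K) -> sdaha n u},
    (forall f s g,
       mult (tens (tens f s) g)
       = skewpoly_in u f * spinsym_in u s * poly_in u g) /\
    bijective mult.
Proof.
have [mu bij_mu muE] := pbw_sig.
exists mu; split; last exact: bij_mu.
exact: muE.
Qed.
End Main.

Theorem theorem3p2 (R : realType) (n : nat) (n_gt0 : (0 < n)%N) (u : R[i]) :
  exists mult : {linear tensor (tensor (skewpoly R[i] n) (spinsym R[i] n))
                               (mpoly n R[i]) -> sdaha n u},
    (forall f s g,
       mult (tens (tens f s) g)
       = skewpoly_in u f * spinsym_in u s * poly_in u g) /\
    bijective mult.
Proof. exact: pbw. Qed.
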